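(* Let $0<p\le 1$ (possibly depending on $n$), and consider the lazy dispersion process with parameter $p$ on the complete graph $K_n$ with $M=(1-\delta)n$ particles initially at a single vertex. (i) If $\delta=\frac p2+\alpha$ for some $\alpha>0$ (possibly depending on $n$), then with probability $1-O(1/n)$ the process terminates in $\mathbf T_{\text{Disp}}=O((p\alpha)^{-1}\log n)$ steps. (ii) If $\delta=\frac p2-\alpha$ for some $\alpha>0$ (possibly depending on $n$), then there exists a constant $c>0$ such that $\Pr(\mathbf T_{\text{Disp}}\le e^{cnp^2\alpha^3}) < e^{-cnp^2\alpha^3}$.
   Context: Lazy dispersion with parameter $p\in(0,1]$: particles start at one vertex; the process is synchronous in discrete time steps. At each step, every particle that shares its current vertex with at least one other particle (at the beginning of the step) independently, with probability $p$, moves to a uniformly random neighbour of its vertex, and with probability $1-p$ stays put; a particle alone at its vertex does not move. The process ends at the first step when every vertex holds at most one particle; $\mathbf T_{\text{Disp}}$ is this number of steps. *)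

(* Defs.v *)
(* MathComp-Analysis *)
From HB Require Import structures.
From mathcomp Require Import all_boot all_order all_algebra.
From mathcomp Require Import all_classical all_reals all_analysis.
Set Implicit Arguments.
Unset Strict Implicit.
Unset Printing Implicit Defensive.
Import Order.TTheory GRing.Theory Num.Theory.
Local Open Scope classical_set_scope.
Local Open Scope ring_scope.

(* Particles are labelled by 'I_M; a configuration sends each to its vertex. *)
Definition config (V : finType) (M : nat) := {ffun 'I_M -> V}.

Definition crowded (V : finType) (M : nat) (x : config V M) (i : 'I_M) : bool :=
  [exists j : 'I_M, (j != i) && (x j == x i)].

Definition dispersed (V : finType) (M : nat) (x : config V M) : bool :=
  [forall v : V, (#|[set i : 'I_M | x i == v]%SET| <= 1)%N].

Definition degree (V : finType) (e : rel V) (v : V) : nat :=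
  #|[set u : V | e v u]%SET|.

(* Probability that particle i of x is at w after one step. *)
Definition particle_prob (R : realType) (V : finType) (e : rel V) (p : R)
    (M : nat) (x : config V M) (i : 'I_M) (w : V) : R :=
  if crowded x i then
    p * ((e (x i) w)%:R / (degree e (x i))%:R) + (1 - p) * (w == x i)%:R
  else (w == x i)%:R.

(* The product over i expresses that the particles act independently. *)
Definition step_prob (R : realType) (V : finType) (e : rel V) (p : R)
    (M : nat) (x y : config V M) : R :=
  \prod_(i < M) particle_prob e p x i (y i).

(* The law is specified multiplicatively, so that no conditioning on events
   of probability 0 occurs: given any history x 0, ..., x t, the next
   configuration has law [step_prob e p (x t)]. *)
Record lazy_dispersion (R : realType) (d : measure_display)
    (Omega : measurableType d) (P : probability Omega R)
    (V : finType) (e : rel V) (p : R) (M : nat) (v0 : V)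
    (X : nat -> Omega -> config V M) : Prop := LazyDispersion {
  dispersion_measurable : forall (t : nat) (x : config V M),
    measurable [set w | X t w = x] ;
  dispersion_start : P [set w | X 0%N w = [ffun=> v0]] = 1%E ;
  dispersion_step : forall (t : nat) (x : nat -> config V M),
    P [set w | forall s, (s <= t.+1)%N -> X s w = x s] =
    (P [set w | forall s, (s <= t)%N -> X s w = x s] *
      (step_prob e p (x t) (x t.+1))%:E)%E }.

(* First step at which the configuration is dispersed; +oo if there is none. *)
Definition T_Disp (R : realType) (Omega : Type) (V : finType) (M : nat)
    (X : nat -> Omega -> config V M) (w : Omega) : \bar R :=
  ereal_inf [set (t%:R)%:E | t in [set t : nat | dispersed (X t w)]].

Definition complete_graph (n : nat) : rel 'I_n := fun u v => u != v.

(* Main.v *)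
(**
For (i), let the excess be the number of particles minus the number of occupied
vertices.  It vanishes exactly on dispersed configurations, and on a complete
graph its expectation is multiplied by at most 1 - p alpha / 2 in each step, so
Markov's inequality after about 4 log n / (p alpha) steps suffices.

For (ii), let U be the number of crowded particles.  Moving one particle changes
U by at most 2 and only crowded particles move, so a bounded differences
argument gives E exp(-th U') <= exp(4 th^2 U - th E U') for the next value U'.
When U <= 2 alpha n / 5 one has E U' >= (1 + p alpha) U, and always
E U' >= U^2 / (32 n).  With th proportional to p alpha, exp(-th U) is therefore
a supermartingale up to an error exp(-const p alpha^3 n) per step, and a union
bound over time concludes once exp(c n p^2 alpha^3) >= 2.  Otherwise only the
first step matters, and from the initial configuration, where every particle is
crowded, the same estimates show that it disperses with probability at most
exp(-const n).
*)
Require Import Defs.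
From HB Require Import structures.
From mathcomp Require Import all_boot all_order all_algebra.
From mathcomp Require Import all_classical all_reals all_analysis.
From mathcomp Require Import ring lra zify.
Set Implicit Arguments.
Unset Strict Implicit.
Unset Printing Implicit Defensive.
Import Order.TTheory GRing.Theory Num.Theory.
Local Open Scope classical_set_scope.
Local Open Scope ring_scope.

(** * Expectations over independent coordinates *)

Definition is_distr (R : realType) (V : finType) (nu : V -> R) : Prop :=
  (forall w, 0 <= nu w) /\ \sum_w nu w = 1.

(** With [mu := particle_prob e p x], this is the expectation of [f] after one step from [x]. *)
Definition prodE (R : realType) (V : finType) (M : nat) (mu : 'I_M -> V -> R)
    (f : config V M -> R) : R :=
  \sum_(y : config V M) (\prod_i mu i (y i)) * f y.

Lemma prodE_prod (R : realType) (V : finType) (M : nat) (mu g : 'I_M -> V -> R) :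
  prodE mu (fun y => \prod_i g i (y i)) = \prod_i \sum_w mu i w * g i w.
Proof.
by rewrite bigA_distr_bigA; apply: eq_bigr => y _; rewrite -big_split.
Qed.

Lemma eq_prodE (R : realType) (V : finType) (M : nat) (mu : 'I_M -> V -> R)
    (f g : config V M -> R) : f =1 g -> prodE mu f = prodE mu g.
Proof. by move=> fg; apply: eq_bigr => y _; rewrite fg. Qed.

Lemma prodE_sum (R : realType) (V : finType) (M : nat) (mu : 'I_M -> V -> R)
    (I : finType) (A : {pred I}) (f : I -> config V M -> R) :
  prodE mu (fun y => \sum_(k in A) f k y) = \sum_(k in A) prodE mu (f k).
Proof.
by rewrite exchange_big; apply: eq_bigr => y _; rewrite mulr_sumr.
Qed.

Lemma prodED (R : realType) (V : finType) (M : nat) (mu : 'I_M -> V -> R)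
    (f g : config V M -> R) :
  prodE mu (fun y => f y + g y) = prodE mu f + prodE mu g.
Proof. by rewrite -big_split; apply: eq_bigr => y _; rewrite mulrDr. Qed.

Lemma prodEZ (R : realType) (V : finType) (M : nat) (mu : 'I_M -> V -> R)
    (c : R) (f : config V M -> R) :
  prodE mu (fun y => c * f y) = c * prodE mu f.
Proof. by rewrite mulr_sumr; apply: eq_bigr => y _; rewrite mulrCA. Qed.

Lemma prodE_cst (R : realType) (V : finType) (M : nat) (mu : 'I_M -> V -> R)
    (c : R) : (forall i, is_distr (mu i)) -> prodE mu (fun=> c) = c.
Proof.
move=> mu1; rewrite /prodE -mulr_suml -bigA_distr_bigA big1 ?mul1r// => i _.
by case: (mu1 i).
Qed.

Lemma le_prodE (R : realType) (V : finType) (M : nat) (mu : 'I_M -> V -> R)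
    (f g : config V M -> R) :
  (forall i, is_distr (mu i)) -> (forall y, f y <= g y) ->
  prodE mu f <= prodE mu g.
Proof.
move=> mu1 fg; apply: ler_sum => y _; apply: ler_wpM2l => //.
by apply: prodr_ge0 => i _; case: (mu1 i).
Qed.

(** * Bounded differences *)

Definition upd (V : finType) (M : nat) (y : config V M) (i : 'I_M) (w : V) :
  config V M := [ffun j => if j == i then w else y j].

Lemma upd_same (V : finType) (M : nat) (y : config V M) (i : 'I_M) (w z : V) :
  upd (upd y i w) i z = upd y i z.
Proof. by apply/ffunP => j; rewrite !ffunE; case: eqP. Qed.

Lemma updC (V : finType) (M : nat) (y : config V M) (i j : 'I_M) (w z : V) :
  i != j -> upd (upd y i w) j z = upd (upd y j z) i w.
Proof.
move=> ij; apply/ffunP => k; rewrite !ffunE; case: (eqVneq k j) => // ->.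
by rewrite eq_sym (negPf ij).
Qed.

Lemma upd_id (V : finType) (M : nat) (y : config V M) (i : 'I_M) :
  upd y i (y i) = y.
Proof. by apply/ffunP => j; rewrite !ffunE; case: eqP => // ->. Qed.

(** The conditional expectation of [f] given all coordinates except [i]. *)
Definition resample (R : realType) (V : finType) (M : nat) (mu : 'I_M -> V -> R)
    (i : 'I_M) (f : config V M -> R) : config V M -> R :=
  fun y => \sum_w mu i w * f (upd y i w).

(* The involution exchanging the old and the new value of coordinate i
   preserves the product weights. *)
Lemma prodE_resample (R : realType) (V : finType) (M : nat)
    (mu : 'I_M -> V -> R) (i : 'I_M) (f : config V M -> R) :
  is_distr (mu i) -> prodE mu (resample mu i f) = prodE mu f.
Proof.
move=> [mu0 mu1].
pose W (u : config V M * V) := (\prod_j mu j (u.1 j)) * mu i u.2.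
pose swap (u : config V M * V) := (upd u.1 i u.2, u.1 i).
have swapK : involutive swap.
  by move=> [y w]; rewrite /swap /= upd_same upd_id ffunE eqxx.
have WE u : W (swap u) = W u.
  case: u => y w; rewrite /W /= (bigD1 i)//= [in RHS](bigD1 i)//= ffunE eqxx.
  rewrite mulrAC [in RHS]mulrAC [_ * mu i (y i)]mulrC; congr (_ * _).
  by apply: eq_bigr => j ji; rewrite ffunE (negPf ji).
transitivity (\sum_u W u * f (swap u).1).
  rewrite -(pair_bigA _ (fun y w => W (y, w) * f (upd y i w))) /=.
  by apply: eq_bigr => y _; rewrite mulr_sumr; apply: eq_bigr => w _; rewrite mulrA.
rewrite (reindex_inj (inv_inj swapK)).
under eq_bigr => u _ do rewrite WE (swapK u).
rewrite -(pair_bigA _ (fun y w => W (y, w) * f y)) /=.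
by apply: eq_bigr => y _; rewrite /W /= -mulr_suml -mulr_sumr mu1 mulr1.
Qed.

(* From [expR (x / 2) <= (1 - x / 2)^-1], squared. *)
Lemma expR_le_quad (R : realType) (x : R) :
  `|x| <= 3^-1 -> expR x <= 1 + x + x ^+ 2.
Proof.
rewrite ler_norml => /andP[x1 x2].
have h : 0 < 1 - x / 2 by lra.
have e1 : expR (x / 2) * (1 - x / 2) <= 1.
  rewrite -[leRHS](expRxMexpNx_1 (x / 2)) ler_wpM2l ?expR_ge0//.
  exact: expR_ge1Dx.
have e2 : expR x * (1 - x / 2) ^+ 2 <= 1.
  have -> : expR x = expR (x / 2) ^+ 2 by rewrite -expRM_natl; congr expR; field.
  by rewrite -exprMn exprn_ile1// mulr_ge0 ?expR_ge0// ltW.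
rewrite -(ler_pM2r (exprn_gt0 2 h)); apply: le_trans e2 _.
have -> : (1 + x + x ^+ 2) * (1 - x / 2) ^+ 2 = 1 + x ^+ 2 * (1 - 3 * x + x ^+ 2) / 4.
  by field.
rewrite lerDl divr_ge0// mulr_ge0 ?sqr_ge0//.
by have := sqr_ge0 x; lra.
Qed.

(** Centre [g] at its mean [m]: an average of values of [g] is within [b] of each of them. In the
    quadratic bound on the exponential the linear term averages to zero, and 1 + s <= exp s
    finishes. *)
Lemma distr_mgf (R : realType) (V : finType) (nu g : V -> R) (b l : R) :
  is_distr nu -> (forall w z, `|g w - g z| <= b) -> `|l| * b <= 3^-1 ->
  \sum_w nu w * expR (l * g w) <= expR (l ^+ 2 * b ^+ 2) * expR (l * \sum_w nu w * g w).
Proof.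
move=> [nu0 nu1] gb lb; set m := \sum_w _ * g w.
have dev w : `|g w - m| <= b.
  have -> : g w - m = \sum_z nu z * (g w - g z).
    by under eq_bigr do rewrite mulrBr; rewrite sumrB -mulr_suml nu1 mul1r.
  apply: le_trans (ler_norm_sum _ _ _) _.
  rewrite -[leRHS]mul1r -nu1 mulr_suml; apply: ler_sum => z _.
  by rewrite normrM ger0_norm// ler_wpM2l.
have step w : nu w * expR (l * g w) <=
    (nu w + l * (nu w * g w - nu w * m) + nu w * (l ^+ 2 * b ^+ 2)) * expR (l * m).
  have -> : l * g w = l * (g w - m) + l * m by ring.
  rewrite expRD mulrA; apply: ler_wpM2r; first exact: expR_ge0.
  have -> : nu w + l * (nu w * g w - nu w * m) + nu w * (l ^+ 2 * b ^+ 2) =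
     nu w * (1 + l * (g w - m) + l ^+ 2 * b ^+ 2) by ring.
  apply: ler_wpM2l => //.
  have lgb : `|l * (g w - m)| <= `|l| * b by rewrite normrM ler_wpM2l.
  apply: le_trans (expR_le_quad (le_trans lgb lb)) _.
  rewrite lerD2l -exprMn -[leLHS]real_normK ?num_real// -[leRHS]real_normK ?num_real//.
  by rewrite ler_sqr ?nnegrE// [leRHS]normrM (ger0_norm (le_trans _ (dev w))).
apply: le_trans (ler_sum _ (fun w _ => step w)) _.
rewrite -mulr_suml; apply: ler_wpM2r; first exact: expR_ge0.
rewrite !big_split /= -mulr_sumr sumrB -!mulr_suml nu1 -/m.
have -> : 1 + l * (m - 1 * m) + 1 * (l ^+ 2 * b ^+ 2) = 1 + l ^+ 2 * b ^+ 2 by ring.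
exact: expR_ge1Dx.
Qed.

(* McDiarmid's bounded differences inequality, with the deterministic
   coordinates contributing nothing to the variance proxy. *)
Lemma bounded_differences_mgf (R : realType) (V : finType) (M : nat)
    (mu : 'I_M -> V -> R) (f : config V M -> R) (A : {set 'I_M}) (b l : R) :
  (forall i, is_distr (mu i)) ->
  (forall i y w z, `|f (upd y i w) - f (upd y i z)| <= b) ->
  (forall i, i \notin A -> exists z, forall w, mu i w = (w == z)%:R) ->
  `|l| * b <= 3^-1 ->
  prodE mu (fun y => expR (l * f y)) <=
  expR (#|A|%:R * (l ^+ 2 * b ^+ 2)) * expR (l * prodE mu f).
Proof.
move=> mu1 fb detA lb.
(* [L s f] averages f over the coordinates in s; resampling all of them turns f
   into the constant [prodE mu f]. *)
pose L s := foldr (resample mu) f s.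
(* Averaging over another coordinate preserves the oscillation bound; averaging over [i] itself
   makes the oscillation 0, and 0 <= b follows from [fb] at equal values. *)
have Lb s i y w z : `|L s (upd y i w) - L s (upd y i z)| <= b.
  elim: s y => [|j s IH] y /=; first exact: fb.
  rewrite /resample -sumrB; under eq_bigr do rewrite -mulrBr.
  apply: le_trans (ler_norm_sum _ _ _) _.
  rewrite -[leRHS]mul1r; case: (mu1 j) => nu0 <-; rewrite mulr_suml.
  apply: ler_sum => u _; rewrite normrM ger0_norm//; apply: ler_wpM2l => //.
  case: (eqVneq i j) => [->|ij]; last by rewrite !(updC _ _ _ ij); exact: IH.
  by rewrite !upd_same subrr normr0; apply: le_trans (fb i y w w).
have EL s : prodE mu (L s) = prodE mu f.
  by elim: s => //= i s IH; rewrite prodE_resample.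
(* Averaging out a coordinate of [A] costs one factor from [distr_mgf]; a coordinate outside [A] is
   deterministic and costs nothing. *)
have key s : uniq s -> prodE mu (fun y => expR (l * f y)) <=
    expR (#|[set i in s | i \in A]%SET|%:R * (l ^+ 2 * b ^+ 2)) *
    prodE mu (fun y => expR (l * L s y)).
  elim: s => [_|i s IH /= /andP[is_ us]].
    have -> : [set i in [::] | i \in A]%SET = finset.set0 by apply/setP => i; rewrite !inE.
    by rewrite cards0 mul0r expR0 mul1r.
  apply: le_trans (IH us) _.
  rewrite -[X in _ * X <= _](@prodE_resample _ _ _ _ i)// -!prodEZ.
  apply: le_prodE => // y.
  have [iA|iA] := boolP (i \in A).
    have -> : [set j in i :: s | j \in A]%SET = (i |: [set j in s | j \in A])%SET.
      by apply/setP => j; rewrite !inE; case: eqP => // ->; rewrite iA.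
    rewrite cardsU1 inE (negPf is_) /= natrD mulrDl mul1r [in leRHS]expRD.
    rewrite -mulrA [leRHS]mulrCA; apply: ler_wpM2l; first exact: expR_ge0.
    by apply: distr_mgf => // w z; exact: Lb.
  have -> : [set j in i :: s | j \in A]%SET = [set j in s | j \in A]%SET.
    by apply/setP => j; rewrite !inE; case: eqP => // ->; rewrite (negPf iA) !andbF.
  apply: ler_wpM2l; first exact: expR_ge0.
  have [z muz] := detA _ iA.
  have sumz (h : V -> R) : \sum_w mu i w * h w = h z.
    rewrite (bigD1 z)//= muz eqxx mul1r big1 ?addr0// => w wz.
    by rewrite muz (negPf wz) mul0r.
  by rewrite /resample !sumz.
have inv s i y w : i \in s -> L s (upd y i w) = L s y.
  elim: s y => //= j s IH y; rewrite inE => ijs; apply: eq_bigr => u _.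
  case: (eqVneq i j) ijs => [-> _|ij /= iis]; first by rewrite upd_same.
  by rewrite updC// IH.
(* The full average depends on no coordinate, so those of [z] can be overwritten one by one by those
   of [y]; a constant equals its own expectation. *)
have Lc y z : L (enum 'I_M) y = L (enum 'I_M) z.
  have : forall s : seq 'I_M, L (enum 'I_M) z =
      L (enum 'I_M) (foldr (fun i x => upd x i (y i)) z s).
    by elim=> //= i s ->; rewrite inv// mem_enum.
  move/(_ (enum 'I_M)) ->; congr (L _ _); apply/ffunP => i.
  have : i \in enum 'I_M by rewrite mem_enum.
  elim: (enum _) => //= j s IH; rewrite inE ffunE; case: eqP => [->//|_ /=]; exact: IH.
have LE y : L (enum 'I_M) y = prodE mu f.
  rewrite -(EL (enum 'I_M)) -[LHS](prodE_cst (L (enum 'I_M) y) mu1).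
  by apply: eq_prodE => z; exact: Lc.
apply: le_trans (key (enum 'I_M) (enum_uniq _)) _.
have -> : [set i in enum 'I_M | i \in A]%SET = A by apply/setP => i; rewrite !inE mem_enum.
apply: ler_wpM2l; first exact: expR_ge0.
by under eq_prodE do rewrite LE; rewrite (prodE_cst _ mu1).
Qed.

(** * One step of the process *)

Definition crowd (V : finType) (M : nat) (x : config V M) : {set 'I_M} :=
  [set i | crowded x i]%SET.

(** On n vertices the excess is written M - n + [#|empties x|], whose only random term is a sum of
    indicators. *)
Definition empties (V : finType) (M : nat) (x : config V M) : {set V} :=
  [set v | [forall i, x i != v]]%SET.

Lemma dispersedE (V : finType) (M : nat) (x : config V M) :
  dispersed x = (#|crowd x| == 0).
Proof.
rewrite cards_eq0; apply/forallP/eqP => [dx|/setP cx v].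
  apply/setP => i; rewrite !inE; apply/negbTE/negP => /existsP[j /andP[ji /eqP xji]].
  move/card_le1_eqP: (dx (x i)) => /(_ j i); rewrite !inE xji eqxx => /(_ isT isT) ij.
  by rewrite ij eqxx in ji.
apply/card_le1_eqP => i j; rewrite !inE => /eqP xi /eqP xj.
apply/eqP/negP => /negP ij; move: (cx j); rewrite !inE => /negbT/negP; apply.
by apply/existsP; exists i; rewrite eq_sym ij xi xj eqxx.
Qed.

(** A dispersed configuration is injective. This settles the case M > n of (ii). *)
Lemma dispersed_leq (V : finType) (M : nat) (x : config V M) :
  dispersed x -> (M <= #|V|)%N.
Proof.
move=> /forallP dx; rewrite -[M in (M <= _)%N]card_ord; apply: (@leq_card _ _ x).
by move=> i j xij; move/card_le1_eqP: (dx (x i)); apply; rewrite !inE// xij.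
Qed.

(* Beyond particle i itself, only the unique other occupant of w can stop being
   crowded when i leaves w. *)
Lemma crowd_upd (V : finType) (M : nat) (y : config V M) (i : 'I_M) (w z : V) :
  (#|crowd (upd y i w)| <= #|crowd (upd y i z)| + 2)%N.
Proof.
pose D := (crowd (upd y i w) :\: crowd (upd y i z) :\ i)%SET.
have D1 : (#|D| <= 1)%N.
  have inD j : j \in D -> y j = w /\ (forall k, k != i -> k != j -> y k != y j) /\ j != i.
    rewrite !inE => /and3P[ji /negP nc /existsP[k /andP[kj]]].
    rewrite !ffunE (negPf ji) => yk.
    have ncr l : l != i -> l != j -> y l != y j.
      move=> li lj; apply/eqP => yl; apply: nc; apply/existsP; exists l.
      by rewrite lj !ffunE (negPf li) (negPf ji) yl eqxx.
    split=> //; move: yk; case: (eqVneq k i) => [_ /eqP//|ki /eqP yk].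
    by move: (ncr _ ki kj); rewrite yk eqxx.
  apply/card_le1_eqP => j k /inD[yj [hj ji]] /inD[yk [hk ki]].
  apply/eqP/negP => /negP jk; have := hj k ki.
  by rewrite jk yj yk eqxx => /(_ isT).
apply: (@leq_trans #|crowd (upd y i z) :|: (i |: D)|%SET).
  by apply: subset_leq_card; apply/fintype.subsetP => j; rewrite !inE;
     case: (crowded (upd y i z) j); case: (j == i).
apply: leq_trans (leq_card_setU _ _) _; rewrite leq_add2l cardsU1.
by move: D1; case: (i \in D) => /=; lia.
Qed.

(** Splitting by the vertex [w] of particle [i] turns the indicator of being alone into a sum of
    products over coordinates, to which independence applies. *)
Lemma prodE_alone (R : realType) (V : finType) (M : nat) (mu : 'I_M -> V -> R)
    (i : 'I_M) : (forall i, is_distr (mu i)) ->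
  prodE mu (fun y => (~~ crowded y i)%:R) =
  \sum_w mu i w * \prod_(j | j != i) (1 - mu j w).
Proof.
move=> mu1.
pose g (w : V) (j : 'I_M) (u : V) : R := if j == i then (u == w)%:R else (u != w)%:R.
have dE (y : config V M) : (~~ crowded y i)%:R = \sum_(w in V) \prod_j g w j (y j) :> R.
  rewrite (bigD1 (y i))//= [X in _ + X]big1 ?addr0; last first.
    by move=> w wi; rewrite (bigD1 i)//= /g eqxx eq_sym (negPf wi) mul0r.
  have [/existsP[j /andP[ji /eqP yj]]|/existsPn nc] := boolP (crowded y i).
    by rewrite (bigD1 j)//= /g (negPf ji) yj eqxx mul0r.
  rewrite big1// => j _; rewrite /g; case: eqP => [->|/eqP ji]; first by rewrite eqxx.
  by have := nc j; rewrite ji /= => ->.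
rewrite (eq_prodE _ dE) prodE_sum; apply: eq_bigr => w _.
rewrite prodE_prod (bigD1 i)//=; congr (_ * _).
  rewrite (bigD1 w)//= /g !eqxx mulr1 big1 ?addr0// => u /negPf uw.
  by rewrite uw mulr0.
apply: eq_bigr => j /negPf ji; have [_ <-] := mu1 j.
rewrite [in RHS](bigD1 w)//= addrC addrK (bigD1 w)//= /g ji eqxx mulr0 add0r.
by apply: eq_bigr => u ->; rewrite mulr1.
Qed.

Lemma prodE_crowd (R : realType) (V : finType) (M : nat) (mu : 'I_M -> V -> R) :
  (forall i, is_distr (mu i)) ->
  prodE mu (fun y => #|crowd y|%:R) =
  \sum_i \sum_w mu i w * (1 - \prod_(j | j != i) (1 - mu j w)).
Proof.
move=> mu1.
have cE (y : config V M) : #|crowd y|%:R = \sum_(i in 'I_M) (1 + -1 * (~~ crowded y i)%:R) :> R.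
  rewrite -sum1_card natr_sum big_mkcond /=; apply: eq_bigr => i _.
  by rewrite inE; case: crowded; rewrite /= ?mulr0 ?addr0 ?mulr1 ?subrr.
rewrite (eq_prodE _ cE) prodE_sum; apply: eq_bigr => i _.
rewrite prodED prodEZ (prodE_cst _ mu1) (prodE_alone _ mu1).
under [RHS]eq_bigr do rewrite mulrBr mulr1.
by rewrite sumrB mulN1r; have [_ ->] := mu1 i.
Qed.

Lemma prodE_empties (R : realType) (V : finType) (M : nat) (mu : 'I_M -> V -> R) :
  (forall i, is_distr (mu i)) ->
  prodE mu (fun y => #|empties y|%:R) = \sum_v \prod_i (1 - mu i v).
Proof.
move=> mu1.
have cE (y : config V M) : #|empties y|%:R = \sum_(v in V) \prod_(i < M) (y i != v)%:R :> R.
  rewrite -sum1_card natr_sum big_mkcond /=; apply: eq_bigr => v _.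
  rewrite inE; have [/forallP h|/forallPn[i]] := boolP [forall i, y i != v].
    by rewrite big1// => i _; rewrite h.
  by rewrite (bigD1 i)//= => /negPf ->; rewrite mul0r.
rewrite (eq_prodE _ cE) prodE_sum; apply: eq_bigr => v _.
rewrite (prodE_prod _ (fun i u => (u != v)%:R)); apply: eq_bigr => i _.
have [_ s1] := mu1 i; rewrite -[in RHS]s1 [in RHS](bigD1 v)//= addrC addrK.
rewrite (bigD1 v)//= eqxx mulr0 add0r.
by apply: eq_bigr => u ->; rewrite mulr1.
Qed.

(** Binomial expansion cut after the quadratic term, with m^2 in place of m (m - 1); the induction
    step leaves an explicit nonnegative remainder. *)
Lemma exprB1_le (R : realType) (q : R) (m : nat) : 0 <= q <= 1 ->
  (1 - q) ^+ m <= 1 - m%:R * q + (m%:R * q) ^+ 2 / 2.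
Proof.
move=> /andP[q0 q1]; elim: m => [|m IH]; first by rewrite expr0; lra.
rewrite exprS; apply: le_trans (ler_wpM2l _ IH) _; first by rewrite subr_ge0.
rewrite -[m.+1%:R]natr1 -subr_ge0.
have m0 : 0 <= m%:R :> R by [].
have -> : 1 - (m%:R + 1) * q + ((m%:R + 1) * q) ^+ 2 / 2 -
   (1 - q) * (1 - m%:R * q + (m%:R * q) ^+ 2 / 2) =
   (q ^+ 2 + (m%:R * q) ^+ 2 * q) / 2 by field.
by rewrite divr_ge0// addr_ge0 ?sqr_ge0// mulr_ge0 ?sqr_ge0.
Qed.

Lemma ler_div_pred (R : realType) (p : R) (n : nat) : (1 < n)%N -> 0 <= p ->
  p / n%:R <= p / n.-1%:R.
Proof.
move=> n1 p0; apply: ler_wpM2l => //.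
by rewrite lef_pV2 ?posrE ?ltr0n ?ler_nat; lia.
Qed.

(** Trades the degree n - 1 for n, which later cancels against the particle number, a multiple of
    n. *)
Lemma exprB1_le_div (R : realType) (p : R) (n m : nat) : (1 < n)%N -> 0 <= p <= 1 ->
  (1 - p / n.-1%:R) ^+ m <= 1 - m%:R * (p / n%:R) + (m%:R * (p / n%:R)) ^+ 2 / 2.
Proof.
move=> n1 /andP[p0 p1].
have n0 : 0 < n.-1%:R :> R by rewrite ltr0n; lia.
have nn : n%:R = n.-1%:R + 1 :> R by rewrite natr1; congr (_%:R); lia.
have q1 := ler_div_pred n1 p0.
apply: le_trans (exprB1_le m _); last first.
  by rewrite divr_ge0//= ler_pdivrMr ?nn; lra.
have h1 : (1 : R) <= n.-1%:R by rewrite ler1n; lia.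
have h2 : p / n.-1%:R <= 1 by rewrite ler_pdivrMr; lra.
by apply: lerXn2r; rewrite ?nnegrE; lra.
Qed.

(** * Transition probabilities on the complete graph *)

Lemma particle_prob_alone (R : realType) (V : finType) (e : rel V) (p : R)
    (M : nat) (x : config V M) (i : 'I_M) (w : V) :
  i \notin crowd x -> particle_prob e p x i w = (w == x i)%:R.
Proof. by rewrite inE /particle_prob => /negPf ->. Qed.

Lemma particle_prob_stay (R : realType) (n : nat) (p : R) (M : nat)
    (x : config 'I_n M) (i : 'I_M) : i \in crowd x ->
  particle_prob (@complete_graph n) p x i (x i) = 1 - p.
Proof.
by rewrite inE /particle_prob /complete_graph => ->; rewrite !eqxx mul0r mulr0 add0r mulr1.
Qed.

Lemma particle_prob_move (R : realType) (n : nat) (p : R) (M : nat)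
    (x : config 'I_n M) (i : 'I_M) (w : 'I_n) : i \in crowd x -> w != x i ->
  particle_prob (@complete_graph n) p x i w = p / n.-1%:R.
Proof.
rewrite inE /particle_prob => -> wi; rewrite (negPf wi) mulr0 addr0.
rewrite /degree /complete_graph eq_sym wi mul1r; congr (_ / _%:R).
rewrite -[n in RHS]card_ord -(cardsC1 (x i)); apply: eq_card => u.
by rewrite !inE eq_sym.
Qed.

Lemma particle_prob_distr (R : realType) (n : nat) (p : R) (M : nat)
    (x : config 'I_n M) (i : 'I_M) : (1 < n)%N -> 0 <= p <= 1 ->
  is_distr (particle_prob (@complete_graph n) p x i).
Proof.
move=> n1 /andP[p0 p1].
have [ic|ic] := boolP (i \in crowd x); last first.
  split=> [w|]; first by rewrite particle_prob_alone.
  rewrite (bigD1 (x i))//= big1 ?addr0 ?particle_prob_alone ?eqxx// => w /negPf wi.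
  by rewrite particle_prob_alone// wi.
split=> [w|].
  have [->|wi] := eqVneq w (x i); first by rewrite particle_prob_stay// subr_ge0.
  by rewrite particle_prob_move// divr_ge0.
rewrite (bigD1 (x i))//= particle_prob_stay//.
rewrite (eq_bigr (fun=> p / n.-1%:R)); last by move=> w wi; rewrite particle_prob_move.
rewrite sumr_const -[X in _ *+ X]/(#|predC1 (x i)|) cardC1 card_ord.
rewrite -[_ *+ n.-1]mulr_natr divfK ?subrK//.
by rewrite pnatr_eq0; lia.
Qed.

(** Bounds the probability that a site is missed by using only the particles in [J]; the other
    factors are at most 1. *)
Lemma prod_le_expr (R : realType) (I : finType) (P : pred I) (J : {set I})
    (a : I -> R) (c : R) :
  (forall j, 0 <= a j <= 1) -> (forall j, j \in J -> P j /\ a j <= c) ->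
  \prod_(j | P j) a j <= c ^+ #|J|.
Proof.
move=> a01 aJ.
have -> : c ^+ #|J| = \prod_(j | P j) (if j \in J then c else 1).
  rewrite -big_mkcondr -prodr_const; apply: eq_bigl => j.
  by have [/aJ[->]|] := boolP (j \in J); rewrite ?andbF.
apply: ler_prod => j _; have /andP[-> a1] /= := a01 j.
by have [/aJ[]|] := boolP (j \in J).
Qed.

Lemma sum_mem_const (R : realType) (V : finType) (A : {set V}) (c : R) :
  \sum_v (v \in A)%:R * c = #|A|%:R * c.
Proof. by rewrite -mulr_suml -natr_sum -big_mkcond sum1_card. Qed.

(** Every vertex is empty, holds a lone particle, or is a crowded site; lone particles occupy
    distinct vertices. *)
Lemma card_empties (n M : nat) (x : config 'I_n M) :
  (#|empties x| + (M - #|crowd x|) + #|[set x i | i in crowd x]%SET| = n)%N.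
Proof.
have eE : empties x = (~: [set x i | i in [set: 'I_M]])%SET.
  apply/setP => v; rewrite !inE.
  apply/forallP/negP => [h /imsetP[i _ vi]|h i]; first by have := h i; rewrite vi eqxx.
  by apply/eqP => xv; apply: h; rewrite -xv; apply: imset_f; rewrite inE.
have noC i j : i \notin crowd x -> x i = x j -> i = j.
  rewrite inE => /existsPn /(_ j) h xij; move: h; rewrite xij eqxx andbT negbK.
  by move/eqP.
have disj : ([set x i | i in crowd x] :&: [set x i | i in ~: crowd x])%SET = finset.set0.
  apply/setP => v; rewrite !inE; apply/negbTE/negP => /andP[/imsetP[j cj ->] /imsetP[i]].
  by rewrite finset.in_setC => ci /esym /(noC _ _ ci) ij; rewrite ij cj in ci.
have card_im : #|[set x i | i in [set: 'I_M]]%SET| =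
    (#|[set x i | i in crowd x]%SET| + (M - #|crowd x|))%N.
  rewrite -(finset.setUCr (crowd x)) imsetU cardsU disj cards0 subn0; congr addn.
  rewrite card_in_imset; last first.
    by move=> i j; rewrite finset.in_setC => ci _; exact: noC.
  by rewrite cardsCs finset.setCK card_ord.
rewrite eE cardsCs finset.setCK card_ord card_im.
have := max_card [set x i | i in [set: 'I_M]]%SET.
by rewrite card_im card_ord; lia.
Qed.

(** Each crowded site holds a crowded particle and its companion, so every fibre of [x] over such a
    site has at least two elements. *)
Lemma card_crowd_imset (V : finType) (M : nat) (x : config V M) :
  (2 * #|[set x i | i in crowd x]%SET| <= #|crowd x|)%N.
Proof.
rewrite -[in leqRHS]sum1_card (partition_big_imset x) /= mulnC -sum_nat_const.
apply: leq_sum => v /imsetP[i ic ->].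
move: (ic); rewrite inE => /existsP[j /andP[ji /eqP xj]].
have jc : j \in crowd x.
  by rewrite inE; apply/existsP; exists i; rewrite eq_sym ji xj eqxx.
rewrite (bigD1 i)/= ?ic ?eqxx// (bigD1 j)/= ?jc ?xj ?eqxx//.
Qed.

Lemma distr_compl_itv (R : realType) (V : finType) (nu : V -> R) (w : V) :
  is_distr nu -> 0 <= 1 - nu w <= 1.
Proof.
move=> [nu0 nu1]; rewrite lerBlDr lerDl nu0 andbT subr_ge0 -nu1 (bigD1 w)//=.
by rewrite lerDl sumr_ge0.
Qed.

(** An empty site stays empty if all crowded particles miss it, a lone particle keeps its site
    occupied, and a crowded site can empty only if two given occupants both leave. *)
Lemma expected_empties_le (R : realType) (n : nat) (p : R) (M : nat)
    (x : config 'I_n M) : (1 < n)%N -> 0 <= p <= 1 ->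
  prodE (particle_prob (@complete_graph n) p x) (fun y => #|empties y|%:R) <=
  #|empties x|%:R * (1 - p / n.-1%:R) ^+ #|crowd x| +
  #|[set x i | i in crowd x]%SET|%:R * p ^+ 2.
Proof.
move=> n1 p01; have mu1 i := particle_prob_distr x i n1 p01.
rewrite prodE_empties// -!sum_mem_const -big_split /=; apply: ler_sum => v _.
have [p0 p1] := andP p01.
have q0 : 0 <= 1 - p / n.-1%:R.
  rewrite subr_ge0 ler_pdivrMr ?ltr0n; last lia.
  have : (1 : R) <= n.-1%:R by rewrite ler1n; lia.
  lra.
pose a i : R := 1 - particle_prob (@complete_graph n) p x i v.
have a01 i : 0 <= a i <= 1 by exact: distr_compl_itv.
have [ve|] := boolP (v \in empties x).
  rewrite mul1r; apply: le_trans (prod_le_expr (J := crowd x) (c := 1 - p / n.-1%:R) a01 _) _.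
    move=> j jc; split=> //; rewrite /a particle_prob_move//.
    by move: ve; rewrite inE => /forallP/(_ j); rewrite eq_sym.
  by rewrite lerDl mulr_ge0// sqr_ge0.
rewrite inE => /forallPn[i]; rewrite negbK => /eqP xi.
rewrite mul0r add0r.
have [ic|ic] := boolP (i \in crowd x); last first.
  rewrite (bigD1 i)//= /a particle_prob_alone// xi eqxx subrr mul0r.
  by rewrite mulr_ge0// sqr_ge0.
have -> : v \in [set x i | i in crowd x]%SET by rewrite -xi imset_f.
rewrite mul1r.
move: (ic); rewrite inE => /existsP[j /andP[ji /eqP xj]].
have jc : j \in crowd x.
  by rewrite inE; apply/existsP; exists i; rewrite eq_sym ji xj eqxx.
have c2 : #|[set i; j]%SET| = 2%N by rewrite cards2 eq_sym ji.
rewrite -c2; apply: (prod_le_expr (P := xpredT) (J := [set i; j]%SET) (a := a) a01) => k.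
rewrite !inE => /orP[]/eqP->; split => //.
  by rewrite /a -xi particle_prob_stay//; lra.
by rewrite /a -xi -xj particle_prob_stay//; lra.
Qed.

(* Here U and S stand for the numbers of crowded particles and crowded sites, so
   that the excess (particles minus occupied sites) is U - S. *)
Lemma excess_drift_ineq (R : realType) (p al n U S : R) :
  0 <= p <= 1 -> 0 <= al -> 0 < n -> 0 <= U <= n -> 0 <= S -> 2 * S <= U ->
  ((p / 2 + al) * n + U - S) * (1 - U * (p / n) + (U * (p / n)) ^+ 2 / 2) + S * p ^+ 2
    - (p / 2 + al) * n <= (1 - p * al / 2) * (U - S).
Proof.
move=> /andP[p0 p1] al0 n0 /andP[U0 Un] S0 SU.
(* In terms of m = 1 / n the crowded fraction r = U m is polynomial, and U / m^-1 can be replaced by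
   r throughout. *)
have -> : n = n^-1^-1 by rewrite invrK.
set m := n^-1.
have m0 : 0 < m by rewrite invr_gt0.
pose r := U * m.
have r0 : 0 <= r by rewrite mulr_ge0// ltW.
have r1 : r <= 1 by rewrite /r ler_pdivrMr// mul1r.
have UE : U = r * m^-1 by rewrite /r mulfK// gt_eqF.
have rE : U * (p / m^-1) = p * r by rewrite invrK /r; ring.
rewrite rE; clearbody r.
have -> : ((p / 2 + al) / m + U - S) * (1 - p * r + (p * r) ^+ 2 / 2) + S * p ^+ 2
    - (p / 2 + al) / m = U - S + S * p ^+ 2 - ((p / 2 + al) * (r / m) * p
     + (U - S) * p * r) * (1 - p * r / 2).
  by field; rewrite gt_eqF.
rewrite -UE.
have pr : 0 <= p * r <= 1 by rewrite mulr_ge0//= mulr_ile1.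
(* The terms K1 to K6 form a positivity certificate: the right side minus the left is (K1 + K2 + K3
   + K6) / 2 + (K4 + K5) / 4. *)
have k1 : 0 <= p ^+ 2 * (U - 2 * S) by rewrite mulr_ge0 ?sqr_ge0// subr_ge0.
have k2 : 0 <= p * al * U * (1 - p * r) by rewrite !mulr_ge0//; lra.
have k3 : 0 <= p * r * (U - 2 * S) * (1 - p * r / 2).
  by rewrite !mulr_ge0//; lra.
have k4 : 0 <= p * r * U * (1 - p * r).
  by rewrite !mulr_ge0//; lra.
have k5 : 0 <= p * r * U * (1 - p ^+ 2).
  have h5 : 0 <= p * r * U by rewrite !mulr_ge0.
  have h6 : 0 <= 1 - p ^+ 2 by rewrite subr_ge0 exprn_ile1.
  exact: mulr_ge0.
have k6 : 0 <= p * al * S by rewrite !mulr_ge0.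
rewrite -subr_ge0.
set K1 := p ^+ 2 * _ in k1; set K2 := _ * (1 - p * r) in k2; set K3 := _ * (1 - _ / 2) in k3.
set K4 := _ * (1 - p * r) in k4; set K5 := _ * _ in k5; set K6 := _ * S in k6.
have -> : (1 - p * al / 2) * (U - S) - (U - S + S * p ^+ 2 -
    ((p / 2 + al) * U * p + (U - S) * p * r) * (1 - p * r / 2)) =
    (K1 + K2 + K6 + K3) / 2 + (K4 + K5) / 4.
  by rewrite /K1 /K2 /K3 /K4 /K5 /K6; field.
by lra.
Qed.

(** With U crowded particles on S crowded sites, [card_empties] gives excess U - S and (p / 2 + al)
    n + U - S empty sites, which reduces the claim to [excess_drift_ineq]. *)
Lemma excess_drift (R : realType) (n : nat) (p al : R) (M : nat)
    (x : config 'I_n M) : (1 < n)%N -> 0 <= p <= 1 -> 0 <= al ->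
  M%:R = (1 - (p / 2 + al)) * n%:R ->
  prodE (particle_prob (@complete_graph n) p x)
    (fun y => M%:R - n%:R + #|empties y|%:R) <=
  (1 - p * al / 2) * (M%:R - n%:R + #|empties x|%:R).
Proof.
move=> n1 p01 al0 ME; have mu1 i := particle_prob_distr x i n1 p01.
have [p0 p1] := andP p01.
have n0 : 0 < n%:R :> R by rewrite ltr0n; lia.
rewrite prodED prodE_cst//.
apply: le_trans (lerD (lexx _) (expected_empties_le x n1 p01)) _.
have h1 := card_empties x; have h2 := card_crowd_imset x.
have UM : (#|crowd x| <= M)%N by rewrite -[M in (_ <= M)%N]card_ord max_card.
set S := #|[set _ | _ in _]%SET| in h1 h2 *.
have Mn : M%:R <= n%:R :> R by rewrite ME ler_piMl//; lra.
set U := #|crowd x| in h1 h2 UM *.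
have E0 : #|empties x|%:R = n%:R - M%:R + U%:R - S%:R :> R.
  by rewrite -[X in X%:R - _]h1 !natrD natrB//; ring.
have := @excess_drift_ineq R p al n%:R U%:R S%:R p01 al0 n0.
have Un : U%:R <= n%:R :> R by apply: le_trans Mn; rewrite ler_nat.
rewrite Un ler0n => /(_ isT (ler0n _ _)).
rewrite -natrM ler_nat => /(_ h2).
have := exprB1_le_div U n1 p01.
move/(ler_wpM2l (ler0n R #|empties x|)).
rewrite E0 ME.
have -> : n%:R - (1 - (p / 2 + al)) * n%:R + U%:R - S%:R = (p / 2 + al) * n%:R + U%:R - S%:R.
  by ring.
set X := _ * _ ^+ U; set Y := _ * (_ + _ / 2).
by lra.
Qed.

(** * Lower bounds on the expected number of crowded particles *)

Lemma ler_sum_subset (R : realType) (I : finType) (A P : pred I) (F : I -> R) :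
  (forall i, 0 <= F i) -> (forall i, A i -> P i) ->
  \sum_(i | A i) F i <= \sum_(i | P i) F i.
Proof.
move=> F0 AP; rewrite [leLHS]big_mkcond [leRHS]big_mkcond; apply: ler_sum => i _.
by have [/AP ->|_] := boolP (A i) => //; case: ifP.
Qed.

Lemma hit_prob_ge (R : realType) (I : finType) (P : pred I) (a : I -> R) (j : I) :
  (forall k, 0 <= 1 - a k <= 1) -> P j -> a j <= 1 - \prod_(k | P k) (1 - a k).
Proof.
move=> a01 Pj; rewrite (bigD1 j)//=.
have := @prodr_ile1 R I (index_enum I) (fun k => P k && (k != j)) (fun k => 1 - a k)
  (fun k _ => a01 k).
move: (\prod_(_ <- _ | _) _) => Q Q1.
have /andP[aj _] := a01 j.
by have := ler_wpM2l aj Q1; rewrite mulr1; lra.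
Qed.

Lemma alone_site (V : finType) (M : nat) (x : config V M) (i j : 'I_M) :
  i \notin crowd x -> j != i -> x j != x i.
Proof. by rewrite inE => /existsPn /(_ j) h ji; move: h; rewrite ji. Qed.

(* A crowded particle is crowded again if it and a companion both stay, or if it
   hits a lone particle; a lone particle becomes crowded if it is hit. *)
Lemma expected_crowd_ge (R : realType) (n : nat) (p : R) (M : nat)
    (x : config 'I_n M) : (1 < n)%N -> 0 <= p <= 1 ->
  #|crowd x|%:R * ((1 - p) ^+ 2 + (M - #|crowd x|)%:R * (p / n.-1%:R)) +
  (M - #|crowd x|)%:R * (1 - (1 - p / n.-1%:R) ^+ #|crowd x|) <=
  prodE (particle_prob (@complete_graph n) p x) (fun y => #|crowd y|%:R).
Proof.
move=> n1 p01; have mu1 i := particle_prob_distr x i n1 p01.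
have [p0 p1] := andP p01.
rewrite prodE_crowd//; set q := p / n.-1%:R; set mu := particle_prob _ p x.
have q0 : 0 <= q by rewrite divr_ge0.
(* [G i w] is the probability that some particle other than [i] is at [w] after the step. *)
pose G i w : R := 1 - \prod_(j | j != i) (1 - mu j w).
have mu01 j w : 0 <= 1 - mu j w <= 1 by exact: distr_compl_itv.
have G_ge i w j : j != i -> mu j w <= G i w.
  by move=> ji; apply: (hit_prob_ge (P := fun k => k != i) (a := mu^~ w)).
have G0 i w : 0 <= G i w by rewrite subr_ge0; apply: prodr_ile1.
have mu0 i w : 0 <= mu i w by have [] := mu1 i.
have FG0 i w : 0 <= mu i w * G i w by rewrite mulr_ge0.
have cardA : #|(~: crowd x)%SET| = (M - #|crowd x|)%N.
  by rewrite cardsCs finset.setCK card_ord.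
rewrite (bigID (mem (crowd x))) /=; apply: lerD.
  rewrite -sumr_const mulr_suml; apply: ler_sum => i ic; rewrite mul1r.
  rewrite (bigD1 (x i))//=; apply: lerD.
    rewrite expr2 /mu particle_prob_stay//; apply: ler_wpM2l; first by rewrite subr_ge0.
    move: (ic); rewrite inE => /existsP[j /andP[ji /eqP xj]].
    have jc : j \in crowd x.
      by rewrite inE; apply/existsP; exists i; rewrite eq_sym ji xj eqxx.
    by apply: le_trans (G_ge _ _ _ ji); rewrite -xj /mu particle_prob_stay.
  (* The sites of lone particles: whoever moves there surely finds company. [x] is injective on lone
     particles, so there are M - U such sites. *)
  pose HV := [set x h | h in (~: crowd x)%SET]%SET.
  have HVi w : w \in HV -> w != x i.
    move=> /imsetP[h]; rewrite finset.in_setC => hc ->; rewrite eq_sym alone_site//.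
    by apply: contraNneq hc => <-.
  apply: le_trans (ler_sum_subset (A := mem HV) _ HVi); last by move=> w; exact: FG0.
  have <- : #|HV| = (M - #|crowd x|)%N.
    rewrite card_in_imset// => h k; rewrite !finset.in_setC => hc _ /eqP.
    by have [//|kh] := eqVneq k h; rewrite eq_sym (negPf (alone_site hc kh)).
  rewrite -sumr_const mulr_suml; apply: ler_sum => w wH; rewrite mul1r.
  rewrite /mu particle_prob_move ?HVi//; apply: ler_peMr => //.
  move: wH => /imsetP[h]; rewrite finset.in_setC => hc ->.
  have hi : h != i by apply: contraNneq hc => ->.
  by apply: le_trans (G_ge _ _ _ hi); rewrite /mu particle_prob_alone// eqxx.
have -> : \sum_(i | i \notin crowd x) \sum_w mu i w * G i w =
    \sum_(i in (~: crowd x)%SET) \sum_w mu i w * G i w.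
  by apply: eq_bigl => i; rewrite finset.in_setC.
rewrite -cardA -sumr_const mulr_suml; apply: ler_sum => i.
rewrite finset.in_setC => ic; rewrite mul1r.
apply: le_trans (ler_sum_subset (A := pred1 (x i)) _ _) => //.
rewrite big_pred1_eq /mu particle_prob_alone// eqxx mul1r /G lerB//.
apply: prod_le_expr => // j jc; split; first by apply: contraTneq jc => ->.
rewrite /mu particle_prob_move// eq_sym alone_site//.
by apply: contraTneq jc => ->.
Qed.

(* Counts only the collisions among movers, which is what matters when p is
   close to 1 and almost all particles are crowded. *)
Lemma expected_crowd_ge_pairs (R : realType) (n : nat) (p : R) (M : nat)
    (x : config 'I_n M) : (1 < n)%N -> (M <= n)%N -> 0 <= p <= 1 ->
  #|crowd x|%:R * ((p / n.-1%:R) ^+ 2 / 2 * (#|crowd x|.-1 * n.-2 + 1)%:R) <=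
  prodE (particle_prob (@complete_graph n) p x) (fun y => #|crowd y|%:R).
Proof.
move=> n1 Mn p01; have mu1 i := particle_prob_distr x i n1 p01.
have [p0 p1] := andP p01.
rewrite prodE_crowd//; set q := p / n.-1%:R; set mu := particle_prob _ p x.
have n10 : 0 < n.-1%:R :> R by rewrite ltr0n; lia.
have q0 : 0 <= q by rewrite divr_ge0.
have q1 : q <= 1.
  rewrite ler_pdivrMr//; have : (1 : R) <= n.-1%:R by rewrite ler1n; lia.
  lra.
pose G i w : R := 1 - \prod_(j | j != i) (1 - mu j w).
have mu01 j w : 0 <= 1 - mu j w <= 1 by exact: distr_compl_itv.
have G0 i w : 0 <= G i w by rewrite subr_ge0; apply: prodr_ile1.
have mu0 i w : 0 <= mu i w by have [] := mu1 i.
have FG0 i w : 0 <= mu i w * G i w by rewrite mulr_ge0.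
pose J i w := [set j in crowd x | (j != i) && (x j != w)]%SET.
(* The particles in [J i w] can reach [w] only by moving. With N of them, a hit has probability at
   least N q - (N q)^2 / 2 >= N q / 2, because N q <= 1. *)
have GJ i w : q * #|J i w|%:R / 2 <= G i w.
  have Nq : #|J i w|%:R * q <= 1.
    rewrite /q mulrA ler_pdivrMr// mul1r.
    have : (#|J i w| <= n.-1)%N.
      apply: (@leq_trans #|[set~ i]%SET|); last by rewrite cardsC1 card_ord; lia.
      by apply: subset_leq_card; apply/fintype.subsetP => j; rewrite !inE => /and3P[].
    rewrite -(ler_nat R) => h; apply: le_trans h.
    by rewrite ler_piMr.
  have Nq0 : 0 <= #|J i w|%:R * q by rewrite mulr_ge0.
  have h : \prod_(j | j != i) (1 - mu j w) <= (1 - q) ^+ #|J i w|.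
    apply: prod_le_expr => // j; rewrite inE => /and3P[jc ji jw]; split=> //.
    by rewrite /mu particle_prob_move// eq_sym.
  have := exprB1_le #|J i w| (introT andP (conj q0 q1)).
  rewrite /G; move: h Nq Nq0; set Pr := \prod_(_ | _) _; set N := #|J i w|%:R.
  move=> h Nq Nq0 h2.
  have : 0 <= (N * q) * (1 - N * q) by rewrite mulr_ge0// subr_ge0.
  by rewrite [q * N]mulrC; nra.
(* The +1 comes from the companions of i, and is needed when n = 2. *)
have cnt i : i \in crowd x -> (#|crowd x|.-1 * n.-2 + 1 <= \sum_(w | w != x i) #|J i w|)%N.
  (* Double counting: for each other crowded [j], count the sites different from both [x i] and
     [x j]. There are n - 1 for a companion of [i], and at least n - 2 otherwise. *)
  move=> ic; have -> : (\sum_(w | w != x i) #|J i w| =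
      \sum_(j in crowd x :\ i) #|[set w : 'I_n | (w != x i) && (w != x j)]%SET|)%N.
    under eq_bigr do rewrite -sum1_card big_mkcond /=.
    rewrite exchange_big /= [RHS]big_mkcond /=; apply: eq_bigr => j _.
    rewrite !inE; have [cj|cj] := boolP (crowded x j); last first.
      by rewrite andbF big1// => w _; rewrite !inE (negPf cj).
    have [ji|ji] := eqVneq j i; first by rewrite big1// => w _; rewrite !inE ji eqxx andbF.
    rewrite -sum1dep_card big_mkcond [RHS]big_mkcond; apply: eq_bigr => w _.
    by rewrite /= !inE cj ji /= [x j == w]eq_sym; case: (w != x i).
  move: (ic); rewrite inE => /existsP[j /andP[ji /eqP xj]].
  have jc : j \in (crowd x :\ i)%SET.
    by rewrite !inE ji; apply/existsP; exists i; rewrite eq_sym ji xj eqxx.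
  rewrite (bigD1 j)//=.
  have -> : [set w : 'I_n | (w != x i) && (w != x j)]%SET = [set~ x i]%SET.
    by apply/setP => w; rewrite !inE xj andbb.
  rewrite cardsC1 card_ord.
  have : (\sum_(k in crowd x :\ i | k != j) n.-2 <=
     \sum_(k in crowd x :\ i | k != j) #|[set w : 'I_n | (w != x i) && (w != x k)]%SET|)%N.
    apply: leq_sum => k _.
    have -> : [set w : 'I_n | (w != x i) && (w != x k)]%SET = (~: [set x i; x k])%SET.
      by apply/setP => w; rewrite !inE negb_or.
    by rewrite cardsCs finset.setCK card_ord cards2; lia.
  rewrite sum_nat_const.
  have -> : #|[pred k in (crowd x :\ i)%SET | k != j]| = (#|crowd x| - 2)%N.
    have -> : #|[pred k in (crowd x :\ i)%SET | k != j]| = #|(crowd x :\ i :\ j)%SET|.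
      by apply: eq_card => k; rewrite !inE andbC.
    by rewrite [in RHS](cardsD1 i) ic (cardsD1 j (_ :\ i)%SET) jc !add1n subn2.
  have : (1 < #|crowd x|)%N.
    by rewrite (cardsD1 i) ic (cardsD1 j (_ :\ i)%SET) jc.
  have -> : n.-1 = n.-2.+1 by lia.
  move: (\sum_(_ in _ | _) _)%N n.-2 => T k; case: #|crowd x| => [//|[//|u]] _.
  by rewrite subn2 /= mulSn; lia.
rewrite (bigID (mem (crowd x))) /= -[leLHS]addr0; apply: lerD; last first.
  by apply: sumr_ge0 => i _; apply: sumr_ge0 => w _; exact: FG0.
rewrite -sumr_const mulr_suml; apply: ler_sum => i ic; rewrite mul1r.
rewrite (bigD1 (x i))//= -[leLHS]add0r; apply: lerD; first exact: FG0.
apply: (@le_trans _ _ (\sum_(w | w != x i) q * (q * #|J i w|%:R / 2))).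
  rewrite -mulr_sumr -mulr_suml -mulr_sumr -natr_sum.
  have := cnt i ic; rewrite -(ler_nat R); set a := _%:R; set b := _%:R => ab.
  have -> : q ^+ 2 / 2 * a = q * (q * a / 2) by field.
  by do ![apply: ler_wpM2l => //]; apply: ler_wpM2r; [lra|apply: ler_wpM2l].
apply: ler_sum => w wi; rewrite /mu particle_prob_move//; apply: ler_wpM2l => //; exact: GJ.
Qed.

(** Bounded differences with constant 2 from [crowd_upd], where only crowded particles are random;
    th <= 1/6 ensures 2 th <= 1/3. *)
Lemma crowd_mgf (R : realType) (n : nat) (p : R) (M : nat)
    (x : config 'I_n M) (th : R) : (1 < n)%N -> 0 <= p <= 1 -> 0 <= th <= 6^-1 ->
  prodE (particle_prob (@complete_graph n) p x) (fun y => expR (- (th * #|crowd y|%:R))) <=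
  expR (4 * th ^+ 2 * #|crowd x|%:R -
        th * prodE (particle_prob (@complete_graph n) p x) (fun y => #|crowd y|%:R)).
Proof.
move=> n1 p01 /andP[th0 th1]; have mu1 i := particle_prob_distr x i n1 p01.
have := @bounded_differences_mgf R _ M (particle_prob (@complete_graph n) p x)
  (fun y => #|crowd y|%:R) (crowd x) 2 (- th) mu1.
under eq_prodE do rewrite mulNr.
rewrite -expRD mulNr; have -> : #|crowd x|%:R * ((- th) ^+ 2 * 2 ^+ 2) =
  4 * th ^+ 2 * #|crowd x|%:R :> R by ring.
apply.
- move=> i y w z; rewrite ler_distlC -natrD ler_nat crowd_upd andbT.
  by rewrite lerBlDr -natrD ler_nat crowd_upd.
- by move=> i ic; exists (x i) => w; rewrite particle_prob_alone.
- by rewrite normrN ger0_norm//; lra.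
Qed.

(** * The law of the configuration at a given time *)

Definition prob (R : realType) (d : measure_display) (Omega : measurableType d)
  (P : probability Omega R) (A : set Omega) : R := fine (P A).

Lemma probE (R : realType) (d : measure_display) (Omega : measurableType d)
    (P : probability Omega R) (A : set Omega) :
  measurable A -> P A = (prob P A)%:E.
Proof. by move=> mA; rewrite fineK// fin_num_measure. Qed.

Lemma prob_partition (R : realType) (d : measure_display) (Omega : measurableType d)
    (P : probability Omega R) (F : finType) (Y : Omega -> F) (A : set Omega) :
  (forall f, measurable [set w | Y w = f]) -> measurable A ->
  prob P A = \sum_f prob P (A `&` [set w | Y w = f]).
Proof.
move=> mY mA; apply: EFin_inj; rewrite -probE// -sumEFin.
rewrite (eq_bigr (fun f => P (A `&` [set w | Y w = f]))); last first.
  by move=> f _; rewrite probE//; exact: measurableI.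
rewrite (fsbig_seq _ _ (index_enum_uniq F)) -measure_fin_bigcup.
- rewrite -setI_bigcupr; congr (P _).
  by apply/seteqP; split=> [w Aw|w []//]; split=> //; exists (Y w) => //=; rewrite mem_index_enum.
- exact: finite_seq.
- by move=> f g _ _ [w [[_ /= <-] [_ /= <-]]].
- by move=> f _; exact: measurableI.
Qed.

Lemma prob_le (R : realType) (d : measure_display) (Omega : measurableType d)
    (P : probability Omega R) (A B : set Omega) :
  measurable A -> measurable B -> A `<=` B -> prob P A <= prob P B.
Proof.
by move=> mA mB AB; rewrite -lee_fin -!probE//; apply: le_measure => //; rewrite inE.
Qed.

Lemma prob_ge0 (R : realType) (d : measure_display) (Omega : measurableType d)
    (P : probability Omega R) (A : set Omega) : 0 <= prob P A.
Proof. exact: fine_ge0. Qed.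

Definition law (R : realType) (d : measure_display) (Omega : measurableType d)
  (P : probability Omega R) (V : finType) (M : nat)
  (X : nat -> Omega -> config V M) (t : nat) (x : config V M) : R :=
  prob P [set w | X t w = x].

Definition lawE (R : realType) (d : measure_display) (Omega : measurableType d)
  (P : probability Omega R) (V : finType) (M : nat)
  (X : nat -> Omega -> config V M) (t : nat) (f : config V M -> R) : R :=
  \sum_x law P X t x * f x.

(* The history of the first t steps takes finitely many values; summing
   [dispersion_step] over them yields the one-step recursion. *)
Lemma law_succ (R : realType) (d : measure_display) (Omega : measurableType d)
    (P : probability Omega R) (V : finType) (e : rel V) (p : R) (M : nat) (v0 : V)
    (X : nat -> Omega -> config V M) (t : nat) (y : config V M) :
  lazy_dispersion P e p v0 X ->
  law P X t.+1 y = \sum_x law P X t x * step_prob e p x y.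
Proof.
move=> [mX _ stepX].
have mpath k (z : nat -> config V M) :
    measurable [set w | forall s, (s <= k)%N -> X s w = z s].
  rewrite (_ : [set _ | _] = \bigcap_(s in [set s | (s <= k)%N]) [set w | X s w = z s])//.
  by apply: bigcap_measurableType => s _; exact: mX.
pose hist w : {ffun 'I_t.+1 -> config V M} := [ffun s : 'I_t.+1 => X s w].
(* The default [y] past time t makes [ext h] take the value [y] at t + 1, so a history followed by
   [y] is an event covered by [dispersion_step]. *)
pose ext (h : {ffun 'I_t.+1 -> config V M}) (s : nat) : config V M :=
  if (s <= t)%N then h (inord s) else y.
have histE h : [set w | hist w = h] = [set w | forall s, (s <= t)%N -> X s w = ext h s].
  apply/seteqP; split=> w /=.
    by move=> <- s st; rewrite /ext st ffunE inordK.
  move=> hw; apply/ffunP => s; rewrite ffunE hw; last by rewrite -ltnS.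
  by rewrite /ext -ltnS ltn_ord inord_val.
have mhist h : measurable [set w | hist w = h] by rewrite histE.
have stepE h : prob P ([set w | X t.+1 w = y] `&` [set w | hist w = h]) =
    prob P [set w | hist w = h] * step_prob e p (h ord_max) y.
  have -> : [set w | X t.+1 w = y] `&` [set w | hist w = h] =
      [set w | forall s, (s <= t.+1)%N -> X s w = ext h s].
    rewrite histE; apply/seteqP; split=> w /=.
      move=> [yw hw] s; rewrite leq_eqVlt => /orP[/eqP ->|]; last exact: hw.
      by rewrite yw /ext ltnn.
    move=> hw; split; last by move=> s st; apply: hw; rewrite leqW.
    by rewrite hw// /ext ltnn.
  apply: EFin_inj; rewrite -probE// stepX EFinM -probE// histE /ext leqnn ltnn.
  by congr (_ * (step_prob _ _ (h _) _)%:E)%E; apply/val_inj; rewrite /= inordK.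
rewrite /law (prob_partition P mhist)//; under eq_bigr do rewrite stepE.
rewrite [RHS](eq_bigr (fun x => \sum_(h : {ffun 'I_t.+1 -> config V M}) (if h ord_max == x
    then prob P [set w | hist w = h] * step_prob e p x y else 0))); last first.
  move=> x _; rewrite (prob_partition P mhist)// mulr_suml; apply: eq_bigr => h _.
  case: eqP => [<-|hx].
    congr (prob P _ * _); apply/seteqP; split=> w /= => [[]//|<-]; split=> //.
    by rewrite ffunE.
  rewrite (_ : _ `&` _ = set0) ?/prob ?measure0 ?mul0r//.
  by rewrite -subset0 => w /= [xw hw]; apply: hx; rewrite -hw ffunE.
rewrite exchange_big /=; apply: eq_bigr => h _.
by rewrite -big_mkcond /= (big_pred1 (h ord_max))// => x; rewrite /= eq_sym.
Qed.

(** The Markov property in integrated form. *)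
Lemma lawE_succ (R : realType) (d : measure_display) (Omega : measurableType d)
    (P : probability Omega R) (V : finType) (e : rel V) (p : R) (M : nat) (v0 : V)
    (X : nat -> Omega -> config V M) (t : nat) (f : config V M -> R) :
  lazy_dispersion P e p v0 X ->
  lawE P X t.+1 f = lawE P X t (fun x => prodE (particle_prob e p x) f).
Proof.
move=> LD; rewrite /lawE; under eq_bigr do rewrite (law_succ _ _ LD) mulr_suml.
rewrite exchange_big; apply: eq_bigr => x _; rewrite mulr_sumr.
by apply: eq_bigr => y _; rewrite mulrA.
Qed.

Lemma sum_law (R : realType) (d : measure_display) (Omega : measurableType d)
    (P : probability Omega R) (V : finType) (M : nat)
    (X : nat -> Omega -> config V M) (t : nat) :
  (forall x, measurable [set w | X t w = x]) -> \sum_x law P X t x = 1.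
Proof.
move=> mX; transitivity (prob P setT); last by rewrite /prob probability_setT.
by rewrite (prob_partition P mX)//; under [RHS]eq_bigr do rewrite setTI.
Qed.

Lemma lawE_start (R : realType) (d : measure_display) (Omega : measurableType d)
    (P : probability Omega R) (V : finType) (e : rel V) (p : R) (M : nat) (v0 : V)
    (X : nat -> Omega -> config V M) (f : config V M -> R) :
  lazy_dispersion P e p v0 X -> lawE P X 0 f = f [ffun=> v0].
Proof.
move=> [mX start _]; rewrite /lawE.
have l0 : law P X 0 [ffun=> v0] = 1 by rewrite /law /prob start.
have l1 := sum_law P (mX 0%N).
rewrite (bigD1 [ffun=> v0])//= l0 mul1r big1 ?addr0// => x xv.
suff -> : law P X 0 x = 0 by rewrite mul0r.
move: l1; rewrite (bigD1 [ffun=> v0])//= l0 => /eqP.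
rewrite -subr_eq0 addrAC subrr add0r psumr_eq0; last by move=> *; exact: prob_ge0.
by move=> /allP/(_ x (mem_index_enum _)); rewrite xv => /eqP.
Qed.

Lemma le_lawE (R : realType) (d : measure_display) (Omega : measurableType d)
    (P : probability Omega R) (V : finType) (M : nat)
    (X : nat -> Omega -> config V M) (t : nat) (f g : config V M -> R) :
  (forall x, f x <= g x) -> lawE P X t f <= lawE P X t g.
Proof.
by move=> fg; apply: ler_sum => x _; apply: ler_wpM2l => //; exact: prob_ge0.
Qed.

Lemma lawE_cst (R : realType) (d : measure_display) (Omega : measurableType d)
    (P : probability Omega R) (V : finType) (M : nat)
    (X : nat -> Omega -> config V M) (t : nat) (c : R) :
  (forall x, measurable [set w | X t w = x]) -> lawE P X t (fun=> c) = c.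
Proof.
by move=> mX; rewrite /lawE -mulr_suml (sum_law P mX) mul1r.
Qed.

(** * Events concerning the dispersion time *)

Lemma measurable_event (d : measure_display) (Omega : measurableType d)
    (F : finType) (Y : Omega -> F) (A : pred F) :
  (forall f, measurable [set w | Y w = f]) -> measurable [set w | A (Y w)].
Proof.
move=> mY; rewrite (_ : [set _ | _] = \bigcup_(f in [set` enum A]) [set w | Y w = f]).
  by apply: fin_bigcup_measurable => //; exact: finite_seq.
apply/seteqP; split=> w /=; first by move=> Aw; exists (Y w) => //=; rewrite mem_enum.
by move=> [f] /=; rewrite mem_enum => Af ->.
Qed.

Lemma prob_event (R : realType) (d : measure_display) (Omega : measurableType d)
    (P : probability Omega R) (V : finType) (M : nat)
    (X : nat -> Omega -> config V M) (t : nat) (A : pred (config V M)) :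
  (forall x, measurable [set w | X t w = x]) ->
  prob P [set w | A (X t w)] = lawE P X t (fun x => (A x)%:R).
Proof.
move=> mX; rewrite (prob_partition P mX (measurable_event A mX)).
apply: eq_bigr => x _; case: (boolP (A x)) => Ax.
  rewrite mulr1; congr (prob P _); apply/seteqP; split=> w /=; first by case.
  by move=> xw; rewrite xw.
rewrite mulr0 (_ : _ `&` _ = set0) /prob ?measure0//.
by rewrite -subset0 => w /= [Aw xw]; move: Ax; rewrite -xw Aw.
Qed.

(* The infimum defining [T_Disp] is over a set of naturals, hence attained. *)
Lemma T_Disp_leP (R : realType) (Omega : Type) (V : finType) (M : nat)
    (X : nat -> Omega -> config V M) (w : Omega) (r : R) :
  (T_Disp R X w <= r%:E)%E <-> exists2 t : nat, t%:R <= r & dispersed (X t w).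
Proof.
split=> [Tr|[t tr dt]]; last first.
  by apply: (@le_trans _ _ (t%:R)%:E); [apply: ereal_inf_lbound; exists t | rewrite lee_fin].
have [t] : exists t : nat, dispersed (X t w).
  apply: contrapT => nd; move: Tr; rewrite /T_Disp.
  have -> : [set t : nat | dispersed (X t w)] = set0.
    by rewrite -subset0 => t dt; apply: nd; exists t.
  by rewrite image_set0 ereal_inf0 leye_eq.
move=> dt; have ex : exists t, dispersed (X t w) by exists t.
case: (ex_minnP ex) => m dm mmin; exists m => //.
rewrite -lee_fin; apply: le_trans Tr; apply: le_ereal_inf_tmp => _ [s ds <-].
by rewrite lee_fin ler_nat mmin.
Qed.

(** A countable union, which yields both measurability and the union bound. *)
Lemma T_Disp_event (R : realType) (Omega : Type) (V : finType) (M : nat)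
    (X : nat -> Omega -> config V M) (r : R) :
  [set w | (T_Disp R X w <= r%:E)%E] =
  \bigcup_(t in [set t : nat | t%:R <= r]) [set w | dispersed (X t w)].
Proof.
apply/seteqP; split=> w /=; first by move/T_Disp_leP => [t tr dt]; exists t.
by move=> [t tr dt]; apply/T_Disp_leP; exists t.
Qed.

(** For p < 1/2, particles staying with a staying companion already give U / 4. For p >= 1/2,
    collisions among movers give order U^2 / n. *)
Lemma expected_crowd_ge_sqr (R : realType) (n : nat) (p : R) (M : nat)
    (x : config 'I_n M) : (1 < n)%N -> (M <= n)%N -> 0 <= p <= 1 ->
  #|crowd x|%:R ^+ 2 / (32 * n%:R) <=
  prodE (particle_prob (@complete_graph n) p x) (fun y => #|crowd y|%:R).
Proof.
move=> n1 Mn p01; have [p0 p1] := andP p01.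
have UM : (#|crowd x| <= M)%N by rewrite -[M in (_ <= M)%N]card_ord max_card.
have n0 : 0 < n%:R :> R by rewrite ltr0n; lia.
(* A crowded particle has a crowded companion; below, a nonzero U can thus be written u + 2. *)
have U1 : #|crowd x| != 1%N.
  have := card_crowd_imset x; case: (set_0Vmem (crowd x)) => [->|[i ic]].
    by rewrite cards0.
  have : (0 < #|[set x i | i in crowd x]%SET|)%N.
    by apply/card_gt0P; exists (x i); exact: imset_f.
  by lia.
have [p2|p2] := ltrP p 2^-1.
  apply: le_trans (expected_crowd_ge x n1 p01).
  set U := #|crowd x|%:R; set H := (M - _)%:R; set q := p / _.
  have q0 : 0 <= q by rewrite divr_ge0.
  have q1 : q <= 1.
    rewrite ler_pdivrMr ?ltr0n; last lia.
    have : (1 : R) <= n.-1%:R by rewrite ler1n; lia.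
    by lra.
  have h1 : 0 <= H * (1 - (1 - q) ^+ #|crowd x|).
    by rewrite mulr_ge0// subr_ge0 exprn_ile1; lra.
  have h2 : 0 <= H * q by rewrite mulr_ge0.
  apply: (@le_trans _ _ (U * 4^-1)).
    rewrite ler_pdivrMr; last lra.
    have : U <= n%:R by rewrite ler_nat (leq_trans UM).
    by have : 0 <= U by []; nra.
  have : U * 4^-1 <= U * ((1 - p) ^+ 2 + H * q).
    by apply: ler_wpM2l => //; nra.
  by lra.
apply: le_trans (expected_crowd_ge_pairs x n1 Mn p01).
have Un : (#|crowd x| <= n)%N := leq_trans UM Mn.
move: #|crowd x| U1 Un => [|[//|u]] _ Un; first by rewrite expr2 !mul0r.
rewrite expr2 -mulrA; apply: ler_wpM2l => //=.
have -> : (p / n.-1%:R) ^+ 2 / 2 * (u.+1 * n.-2 + 1)%:R =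
  p ^+ 2 * ((u.+1 * n.-2 + 1)%:R / (2 * n.-1%:R ^+ 2)).
  by field; rewrite pnatr_eq0; lia.
apply: (@le_trans _ _ (4^-1 * ((u.+1 * n.-2 + 1)%:R / (2 * n.-1%:R ^+ 2)))); last first.
  by apply: ler_wpM2r; [rewrite divr_ge0// mulr_ge0// exprn_ge0 | nra].
have [k kE] : exists k, n = k.+2 by exists n.-2; lia.
rewrite mulrA ler_pdivlMr; last by rewrite mulr_gt0// exprn_gt0// ltr0n; lia.
rewrite mulrAC ler_pdivrMr; last by rewrite mulr_gt0.
(* The inequality with denominators cleared, for U = u + 2 and n = k + 2; it uses U <= n. *)
have hN : (u.+2 * (2 * k.+1 ^ 2) <= 8 * (u.+1 * k + 1) * k.+2)%N.
  by move: Un; rewrite kE expnS expn1; nia.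
move: hN; rewrite -(ler_nat R) !(natrM _ _ k.+2) !(natrM _ u.+2) !(natrM _ 8) (natrM _ 2) natrX.
by rewrite kE /=; move: (_ + 1)%:R => z; lra.
Qed.

(* Up to 2 al n / 5 crowded particles, the upward drift dominates the variance
   term of [crowd_mgf]; above, a single step leaves order al U crowded particles
   except with the probability given by the second summand. *)
Lemma crowd_supermartingale (R : realType) (n : nat) (p al : R) (M : nat)
    (x : config 'I_n M) : (1 < n)%N -> (M <= n)%N -> 0 < p <= 1 -> 0 < al ->
  M%:R = (1 - (p / 2 - al)) * n%:R ->
  forall th, th = p * al / 40 / 40 ->
  prodE (particle_prob (@complete_graph n) p x)
    (fun y => expR (- (th * #|crowd y|%:R))) <=
  expR (- (th * #|crowd x|%:R)) + expR (- (th * al ^+ 2 * n%:R / 10 / 25)).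
Proof.
move=> n1 Mn /andP[p0 p1] al0 ME th thE.
have p01 : 0 <= p <= 1 by rewrite ltW.
have n0 : 0 < n%:R :> R by rewrite ltr0n; lia.
have al2 : al <= p / 2.
  have : M%:R <= 1 * n%:R :> R by rewrite mul1r ler_nat.
  by rewrite ME ler_pM2r//; lra.
have pal : 0 < p * al by rewrite mulr_gt0.
have pal1 : p * al <= al by rewrite ler_piMl// ltW.
have th0 : 0 < th by lra.
have th1 : th <= al / 40 / 40 by lra.
have UM : (#|crowd x| <= M)%N by rewrite -[M in (_ <= M)%N]card_ord max_card.
have th01 : 0 <= th <= 6^-1 by rewrite ltW//=; lra.
apply: le_trans (crowd_mgf x n1 p01 th01) _.
set EU := prodE _ _.
have [Ule|Ugt] := lerP #|crowd x|%:R (2 * al * n%:R / 5).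
  (* With H = M - U lone particles, (1 - p)^2 + 2 p H / n equals 1 + 2 p al - 2 p U / n. The
     quadratic error costs a further p U / (2 n), and the total loss 5 p U / (2 n) is at most p al
     below the threshold. *)
  suff EUge : #|crowd x|%:R * (1 + p * al) <= EU.
    rewrite -[leLHS]addr0; apply: lerD; last exact: expR_ge0.
    rewrite ler_expR; move: EUge => /(ler_wpM2l (ltW th0)).
    have : 0 <= #|crowd x|%:R * (p * al - 4 * th) * th :> R.
      by apply: mulr_ge0; [apply: mulr_ge0; [|lra]|exact: ltW].
    by lra.
  apply: le_trans (expected_crowd_ge x n1 p01).
  have := exprB1_le_div #|crowd x| n1 p01.
  have q1 := ler_div_pred n1 (ltW p0).
  have HE : (M - #|crowd x|)%:R = (1 - (p / 2 - al)) * n%:R - #|crowd x|%:R :> R.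
    by rewrite natrB// ME.
  have H0 : 0 <= (M - #|crowd x|)%:R :> R by [].
  have Hn : (M - #|crowd x|)%:R <= n%:R :> R by rewrite ler_nat (leq_trans (leq_subr _ _)).
  move: H0 Hn HE Ule; set H := (M - _)%:R; set Ex := _ ^+ _; set U := #|crowd x|%:R.
  move=> H0 Hn HE Ule hEx.
  have U0 : 0 <= U by [].
  have hq : U * (H * (p / n%:R)) <= U * (H * (p / n.-1%:R)).
    by apply: ler_wpM2l => //; apply: ler_wpM2l.
  have hE := ler_wpM2l H0 hEx.
  have hH : H * (U * (p / n%:R)) ^+ 2 <= U * p * (U / n%:R).
    have -> : H * (U * (p / n%:R)) ^+ 2 = (H / n%:R * p) * (U * p * (U / n%:R)).
      by field; rewrite gt_eqF.
    rewrite ler_piMl//; last by rewrite mulr_ile1// ?divr_ge0 ?ler_pdivrMr ?mul1r// ltW.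
    by rewrite mulr_ge0// ?divr_ge0// mulr_ge0// ltW.
  have hU : U / n%:R <= 2 * al / 5 by rewrite ler_pdivrMr//; lra.
  have hUU := ler_wpM2l (mulr_ge0 U0 (ltW p0)) hU.
  have HpE : H * (p / n%:R) = p * (1 - (p / 2 - al)) - p * (U / n%:R).
    by rewrite HE; field; rewrite gt_eqF.
  have e1 : H * (U * (p / n%:R)) = U * (H * (p / n%:R)) by ring.
  rewrite HpE in hq e1; lra.
(* Above the threshold E U' >= al U / 80, while 4 th^2 U <= th al U / 400. The exponent is thus at
   most - th al U / 100 <= - th al^2 n / 250. *)
rewrite -[leLHS]add0r; apply: lerD; first exact: expR_ge0.
rewrite ler_expR.
have := expected_crowd_ge_sqr x n1 Mn p01; rewrite -/EU.
move: Ugt; set U := #|crowd x|%:R => Ugt.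
have U0 : 0 <= U by [].
have hU : 2 * al / 5 <= U / n%:R by rewrite ler_pdivlMr//; lra.
have -> : U ^+ 2 / (32 * n%:R) = U * (U / n%:R) / 32 by field; rewrite gt_eqF.
have hUU := ler_wpM2l U0 hU.
move=> hEU.
have hEU2 : U * al / 80 <= EU by lra.
have := ler_wpM2l (ltW th0) hEU2.
have := ler_wpM2l (mulr_ge0 (ltW th0) U0) th1.
have := ler_wpM2l (mulr_ge0 (ltW th0) (ltW al0)) (ltW Ugt).
by lra.
Qed.

(** The excess is the integer U - S with 2 S <= U, hence at least 1 unless U = 0. This is the
    pointwise form of Markov's inequality. *)
Lemma excess_ge (R : realType) (n M : nat) (x : config 'I_n M) :
  (~~ dispersed x)%:R <= M%:R - n%:R + #|empties x|%:R :> R.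
Proof.
rewrite dispersedE; have h1 := card_empties x; have h2 := card_crowd_imset x.
have UM : (#|crowd x| <= M)%N by rewrite -[M in (_ <= M)%N]card_ord max_card.
rewrite -addrA [- _ + _]addrC addrA lerBrDr -!natrD ler_nat.
move: h1 h2 UM; move: #|[set x i | i in crowd x]%SET| #|empties x| #|crowd x| => S E0 U.
by case: eqP; lia.
Qed.

(** * Fast dispersion *)

Lemma lawE_geometric (R : realType) (d : measure_display) (Omega : measurableType d)
    (P : probability Omega R) (V : finType) (e : rel V) (p : R) (M : nat) (v0 : V)
    (X : nat -> Omega -> config V M) (f : config V M -> R) (k : R) (t : nat) :
  lazy_dispersion P e p v0 X -> 0 <= k ->
  (forall x, prodE (particle_prob e p x) f <= k * f x) ->
  lawE P X t f <= k ^+ t * f [ffun=> v0].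
Proof.
move=> LD k0 fk; elim: t => [|t IH]; first by rewrite (lawE_start _ LD) expr0 mul1r.
rewrite (lawE_succ _ _ LD) exprS -mulrA; apply: le_trans (ler_wpM2l k0 IH).
apply: le_trans (le_lawE _ _ _ fk) _.
by rewrite /lawE mulr_sumr; apply: ler_sum => x _; rewrite mulrCA.
Qed.

Lemma fast_dispersion (R : realType) (n M : nat) (p al : R)
    (d : measure_display) (Omega : measurableType d)
    (P : probability Omega R) (v0 : 'I_n) (X : nat -> Omega -> config 'I_n M) :
  (1 < n)%N -> 0 < p <= 1 -> 0 < al -> M%:R = (1 - (p / 2 + al)) * n%:R ->
  lazy_dispersion P (@complete_graph n) p v0 X ->
  ((1 - expR 1 / n%:R)%:E <=
     P [set w | (T_Disp R X w <= (4 * (p * al)^-1 * ln n%:R)%:E)%E])%E.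
Proof.
move=> n1 /andP[p0 p1] al0 ME LD.
have p01 : 0 <= p <= 1 by rewrite ltW.
have n0 : 0 < n%:R :> R by rewrite ltr0n; lia.
have n1R : 1 <= n%:R :> R by rewrite ler1n; lia.
have mX := dispersion_measurable LD.
have pal : 0 < p * al by rewrite mulr_gt0.
(* M >= 0 forces this; it keeps p al <= 1 and the contraction factor nonnegative. *)
have al1 : p / 2 + al <= 1.
  by rewrite -subr_ge0 -(pmulr_lge0 _ n0) -ME.
have pal1 : p * al <= 1 by rewrite mulr_ile1//; lra.
set B := 4 * (p * al)^-1 * ln n%:R.
have B0 : 0 <= B by rewrite !mulr_ge0 ?invr_ge0 ?ln_ge0// ltW.
pose t := Num.truncn B.
have tB : t%:R <= B by rewrite /t truncn_le.
have Bt : B < t%:R + 1 by rewrite natr1 truncnS_gt.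
pose k := 1 - p * al / 2.
have k0 : 0 <= k by rewrite /k; lra.
have mD s : measurable [set w | dispersed (X s w)].
  exact: (measurable_event (fun x => dispersed x)).
have notD : lawE P X t (fun x => (~~ dispersed x)%:R) <= expR 1 / n%:R.
  apply: le_trans (le_lawE _ _ _ (@excess_ge R n M)) _.
  apply: le_trans (lawE_geometric t LD k0 (fun x => excess_drift x n1 p01 (ltW al0) ME)) _.
  apply: (@le_trans _ _ (expR (- (p * al / 2)) ^+ t * n%:R)).
    apply: ler_pM; first by rewrite exprn_ge0.
    - by apply: le_trans (excess_ge _ _).
    - by rewrite lerXn2r ?nnegrE ?expR_ge0// expR_ge1Dx.
    have h1 : #|empties ([ffun=> v0] : config 'I_n M)|%:R <= n%:R :> R.
      by rewrite ler_nat -[n in (_ <= n)%N]card_ord max_card.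
    have : M%:R <= n%:R :> R by rewrite ME ler_piMl//; lra.
    by lra.
  (* Since t > B - 1, the exponent - t p al / 2 is below - 2 ln n + p al / 2. Rounding B down thus
     costs a factor less than e, whence the constant [expR 1]. *)
  rewrite -expRM_natl -[X in _ * X <= _](lnK (_ : n%:R \is Num.pos)) ?posrE//.
  rewrite -[X in _ <= _ / X](lnK (_ : n%:R \is Num.pos)) ?posrE//.
  rewrite -expRB -expRD ler_expR.
  have : B * (p * al) = 4 * ln n%:R by rewrite /B mulrAC divfK// gt_eqF.
  have := ler_wpM2r (ltW pal) (ltW Bt).
  by lra.
have mT : measurable [set w | (T_Disp R X w <= B%:E)%E].
  by rewrite T_Disp_event; apply: bigcup_measurable => s _.
rewrite probE// lee_fin; apply: (@le_trans _ _ (prob P [set w | dispersed (X t w)])); last first.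
  by apply: prob_le => // w /= dt; apply/T_Disp_leP; exists t.
rewrite (prob_event P (fun x => dispersed x))//.
have : lawE P X t (fun=> 1) = lawE P X t (fun x => (dispersed x)%:R) +
    lawE P X t (fun x => (~~ dispersed x)%:R).
  rewrite /lawE -big_split; apply: eq_bigr => x _ /=; rewrite -mulrDr.
  by case: dispersed; rewrite ?addr0 ?add0r.
by rewrite (@lawE_cst R d Omega P _ _ X t 1 (mX t)); lra.
Qed.

(** * Slow dispersion *)

Lemma prob_T_Disp_le (R : realType) (d : measure_display) (Omega : measurableType d)
    (P : probability Omega R) (V : finType) (M : nat)
    (X : nat -> Omega -> config V M) (r : R) :
  (forall t x, measurable [set w | X t w = x]) -> 0 <= r ->
  prob P [set w | (T_Disp R X w <= r%:E)%E] <=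
  \sum_(t < (Num.truncn r).+1) lawE P X t (fun x => (dispersed x)%:R).
Proof.
move=> mX r0.
have mD s : measurable [set w | dispersed (X s w)].
  exact: (measurable_event (fun x => dispersed x)).
have -> : [set w | (T_Disp R X w <= r%:E)%E] =
    \big[setU/set0]_(t < (Num.truncn r).+1) [set w | dispersed (X t w)].
  rewrite T_Disp_event -(bigcup_mkord _ (fun t => [set w | dispersed (X t w)])).
  apply/seteqP; split=> w [t /= tr dt]; exists t => //=.
    by rewrite ltnS truncn_ge_nat.
  by move: tr; rewrite ltnS truncn_ge_nat.
rewrite -lee_fin -probE; last exact: bigsetU_measurable.
apply: (@le_trans _ _ (\sum_(t < (Num.truncn r).+1) P [set w | dispersed (X t w)])%E).
  by apply: (Boole_inequality P (A := fun t => [set w | dispersed (X t w)])).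
rewrite -sumEFin; apply: lee_sum => t _.
by rewrite probE// lee_fin (prob_event P (fun x => dispersed x)).
Qed.

(** Pointwise exponential Markov inequality: with no crowded particle the right side is 1. *)
Lemma dispersed_le_expR (R : realType) (V : finType) (M : nat) (x : config V M) (th : R) :
  (dispersed x)%:R <= expR (- (th * #|crowd x|%:R)).
Proof.
rewrite dispersedE; case: eqP => [->|_]; last exact: expR_ge0.
by rewrite mulr0 oppr0 expR0.
Qed.

Lemma crowd_start (V : finType) (M : nat) (v0 : V) :
  (1 < M)%N -> crowd ([ffun=> v0] : config V M) = [set: 'I_M]%SET.
Proof.
move=> M1; apply/setP => i; rewrite !inE; apply/existsP.
have : (0 < #|[set~ i]%SET|)%N by rewrite cardsC1 card_ord; lia.
by case/card_gt0P => j; rewrite !inE => ji; exists j; rewrite ji !ffunE eqxx.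
Qed.

Lemma first_step_undispersed (R : realType) (n M : nat) (p : R)
    (d : measure_display) (Omega : measurableType d)
    (P : probability Omega R) (v0 : 'I_n) (X : nat -> Omega -> config 'I_n M) :
  (1 < n)%N -> (1 < M)%N -> (M <= n)%N -> n%:R <= 2 * M%:R :> R -> 0 <= p <= 1 ->
  lazy_dispersion P (@complete_graph n) p v0 X ->
  lawE P X 1 (fun x => (dispersed x)%:R) <= expR (- (n%:R * (2^-1) ^+ 17)).
Proof.
move=> n1 M1 Mn nM p01 LD; have mu1 i := particle_prob_distr ([ffun=> v0] : config 'I_n M) i n1 p01.
have n0 : 0 < n%:R :> R by rewrite ltr0n; lia.
(* With E U' >= M / 64, this choice makes the variance term 4 th^2 M half of th M / 64. What remains
   is - th M / 128 = - M / 2^16 <= - n / 2^17. *)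
pose th : R := (2^-1) ^+ 9.
have thE : th = (2^-1) ^+ 9 by [].
have th0 : 0 <= th <= 6^-1.
  by rewrite /th !exprS expr0; lra.
rewrite (lawE_succ _ _ LD) (lawE_start _ LD).
apply: le_trans (_ : _ <= prodE _ (fun y => expR (- (th * #|crowd y|%:R)))) _.
  by apply: le_prodE => y; [exact: mu1|exact: dispersed_le_expR].

apply: le_trans (crowd_mgf _ n1 p01 th0) _.
have := expected_crowd_ge_sqr ([ffun=> v0] : config 'I_n M) n1 Mn p01.
rewrite crowd_start// cardsT card_ord ler_expR; set EU := prodE _ _ => hEU.
have hM : M%:R / 64 <= EU.
  apply: le_trans hEU.
  have -> : M%:R ^+ 2 / (32 * n%:R) = M%:R * (M%:R / n%:R) / 32 :> R.
    by field; rewrite gt_eqF.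
  have : 2^-1 <= M%:R / n%:R :> R by rewrite ler_pdivlMr//; lra.
  by move/(ler_wpM2l (ler0n R M)); lra.
have /andP[h0 _] := th0.
have := ler_wpM2l h0 hM.
have -> : (2^-1) ^+ 17 = 2 * (th * th) :> R by rewrite /th; field.
have t2 : 4 * th = 2^-1 / 64 by rewrite /th; field.
have : n%:R * (th * th) <= 2 * M%:R * (th * th) by rewrite ler_wpM2r// mulr_ge0.
have : 4 * th ^+ 2 * M%:R = th * M%:R * (2^-1 / 64) by rewrite -t2; ring.
by lra.
Qed.

(** Each step adds one error term, and the initial value exp(- th M) is itself at most one such term
    because M >= n / 2. *)
Lemma law_mgf_le (R : realType) (n M : nat) (p al th : R)
    (d : measure_display) (Omega : measurableType d)
    (P : probability Omega R) (v0 : 'I_n) (X : nat -> Omega -> config 'I_n M) (t : nat) :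
  (1 < n)%N -> (1 < M)%N -> (M <= n)%N -> 0 < p <= 1 -> 0 < al ->
  M%:R = (1 - (p / 2 - al)) * n%:R -> th = p * al / 40 / 40 ->
  lazy_dispersion P (@complete_graph n) p v0 X ->
  lawE P X t (fun x => expR (- (th * #|crowd x|%:R))) <=
  t.+1%:R * expR (- (th * al ^+ 2 * n%:R / 10 / 25)).
Proof.
move=> n1 M1 Mn p01 al0 ME thE LD; have [p0 p1] := andP p01.
have n0 : 0 < n%:R :> R by rewrite ltr0n; lia.
have th0 : 0 <= th by rewrite thE !mulr_ge0// ltW.
have al2 : al <= p / 2.
  have : M%:R <= 1 * n%:R :> R by rewrite mul1r ler_nat.
  by rewrite ME ler_pM2r//; lra.
set b := expR _; elim: t => [|t IH].
  rewrite (lawE_start _ LD) crowd_start// cardsT card_ord mul1r ler_expR lerN2.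
  have h1 : al ^+ 2 <= 1 by rewrite exprn_ile1; lra.
  have h2 := ler_wpM2r (ltW n0) h1.
  have h3 : (1 - (p / 2 - al)) * n%:R >= 2^-1 * n%:R by apply: ler_wpM2r; lra.
  have h4 : al ^+ 2 * n%:R / 10 / 25 <= M%:R by rewrite ME; lra.
  by have := ler_wpM2l th0 h4; lra.
have mX := dispersion_measurable LD t.
rewrite (lawE_succ _ _ LD).
apply: le_trans (le_lawE _ _ _ (fun x => crowd_supermartingale x n1 Mn p01 al0 ME thE)) _.
rewrite -/b -[t.+2%:R]natr1 mulrDl mul1r.
have -> : lawE P X t (fun x => expR (- (th * #|crowd x|%:R)) + b) =
    lawE P X t (fun x => expR (- (th * #|crowd x|%:R))) + lawE P X t (fun=> b).
  by rewrite /lawE -big_split; apply: eq_bigr => x _ /=; rewrite -mulrDr.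
by rewrite (@lawE_cst R d Omega P _ _ X t b mX) lerD2r.
Qed.

Lemma slow_dispersion (R : realType) (n M : nat) (p al : R)
    (d : measure_display) (Omega : measurableType d)
    (P : probability Omega R) (v0 : 'I_n) (X : nat -> Omega -> config 'I_n M) :
  (1 < n)%N -> 0 < p <= 1 -> 0 < al -> M%:R = (1 - (p / 2 - al)) * n%:R ->
  lazy_dispersion P (@complete_graph n) p v0 X ->
  let Y := (2^-1) ^+ 22 * n%:R * p ^+ 2 * al ^+ 3 in
  (P [set w | (T_Disp R X w <= (expR Y)%:E)%E] < (expR (- Y))%:E)%E.
Proof.
move=> n1 p01 al0 ME LD /=; have [p0 p1] := andP p01.
set Y := _ * al ^+ 3.
have n0 : 0 < n%:R :> R by rewrite ltr0n; lia.
have mX := dispersion_measurable LD.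
have nM : n%:R < 2 * M%:R :> R.
  have : n%:R * (1 - p) >= 0 by rewrite mulr_ge0//; lra.
  have : 0 < al * n%:R by rewrite mulr_gt0.
  by rewrite ME; lra.
have M1 : (1 < M)%N.
  have : (n < 2 * M)%N by rewrite -(ltr_nat R) natrM.
  by lia.
have [Mn|Mn] := leqP M n; last first.
  rewrite (_ : [set _ | _] = set0) ?measure0 ?lte_fin ?expR_gt0//.
  rewrite -subset0 => w /T_Disp_leP[t _ /dispersed_leq].
  by rewrite card_ord leqNgt Mn.
have al2 : al <= p / 2.
  have : M%:R <= 1 * n%:R :> R by rewrite mul1r ler_nat.
  by rewrite ME ler_pM2r//; lra.
have p01' : 0 <= p <= 1 by rewrite ltW.
have a3 : 0 < al ^+ 3 by rewrite exprn_gt0.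
have a31 : al ^+ 3 <= 1 by rewrite exprn_ile1; lra.
have c0 : 0 < (2^-1) ^+ 22 :> R by rewrite exprn_gt0.
(* The scale of the exponent in [law_mgf_le]; [Y] is 2^-22 p times it. *)
pose W := n%:R * p * al ^+ 3.
have W0 : 0 < W by rewrite !mulr_gt0.
have Wn : W <= n%:R.
  rewrite /W -mulrA; apply: ler_piMr => //.
  by apply: mulr_ile1 => //; exact: ltW.
have YW : Y <= (2^-1) ^+ 22 * W.
  have -> : Y = (2^-1) ^+ 22 * W * p by rewrite /Y /W; ring.
  by rewrite ler_piMr// mulr_ge0//; exact: ltW.
have Y0 : 0 < Y by rewrite /Y !mulr_gt0// exprn_gt0.
have c17 : (2^-1) ^+ 22 = (2^-1) ^+ 17 * (2^-1) ^+ 5 :> R by rewrite -exprD.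
have Yn : Y < n%:R * (2^-1) ^+ 17.
  have h17 : 0 < (2^-1) ^+ 17 :> R by rewrite exprn_gt0.
  have h5 : (2^-1) ^+ 5 <= 2^-1 :> R by rewrite !exprS expr0; lra.
  have h22 : (2^-1) ^+ 22 <= (2^-1) ^+ 17 / 2 :> R by rewrite c17 ler_pM2l.
  have := ler_wpM2r (ltW W0) h22; have := ler_wpM2l (ltW h17) Wn.
  have : 0 < n%:R * (2^-1) ^+ 17 :> R by rewrite mulr_gt0.
  by lra.
pose th := p * al / 40 / 40.
pose b := expR (- (th * al ^+ 2 * n%:R / 10 / 25)).
(* The exponent of [b] is W / 400000, and 6 / 2^22 is smaller than 1 / 400000. The sixth power
   leaves room for two factors 2 E from the union bound. *)
have bY : b <= expR (- Y) ^+ 6.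
  rewrite -expRM_natl ler_expR.
  have -> : th * al ^+ 2 * n%:R / 10 / 25 = W / 40 / 40 / 10 / 25 by rewrite /th /W; field.
  have c6 : 6 * (2^-1) ^+ 22 <= 40^-1 / 40 / 10 / 25 :> R.
    rewrite !exprS expr0; lra.
  by have := ler_wpM2r (ltW W0) c6; lra.
set E := expR Y; have E1 : 1 < E by rewrite /E expR_gt1.
have EF : E * expR (- Y) = 1 := expRxMexpNx_1 Y.
have F0 : 0 < expR (- Y) := expR_gt0 _.
have mD s : measurable [set w | dispersed (X s w)].
  exact: (measurable_event (fun x => dispersed x)).
have mT : measurable [set w | (T_Disp R X w <= E%:E)%E].
  by rewrite T_Disp_event; apply: bigcup_measurable => s _.
rewrite probE// lte_fin.
have E0 : 0 <= E by lra.
apply: le_lt_trans (prob_T_Disp_le P mX E0) _.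
have [E2|E2] := ltrP E 2.
  (* Only times 0 and 1 count: the start is not dispersed since M > 1, and time 1 is handled by
     [first_step_undispersed]. *)
  have -> : Num.truncn E = 1%N by apply: truncn_def; rewrite ltW.
  rewrite big_ord_recl big_ord1 /= (lawE_start _ LD) dispersedE crowd_start//.
  rewrite cardsT card_ord; have -> : (M == 0%N) = false by rewrite gtn_eqF// ltnW.
  rewrite add0r; apply: le_lt_trans (first_step_undispersed n1 M1 Mn (ltW nM) p01' LD) _.
  by rewrite ltr_expR ltrN2.
set N := Num.truncn E.
have NE : N%:R <= E by rewrite truncn_le.
have sumN : \sum_(t < N.+1) lawE P X t (fun x => (dispersed x)%:R) <= N.+1%:R * (N.+1%:R * b).
  rewrite -[X in X%:R * _](card_ord N.+1) -sumr_const mulr_suml; apply: ler_sum => t _.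
  rewrite mul1r; apply: le_trans (le_lawE _ _ _ (fun x => dispersed_le_expR x th)) _.
  apply: le_trans (law_mgf_le t n1 M1 Mn p01 al0 ME _ LD) _ => //.
  by rewrite -/b ler_wpM2r ?expR_ge0// ler_nat.
apply: le_lt_trans sumN _.
have N2 : N.+1%:R <= 2 * E by rewrite -natr1; lra.
apply: (@le_lt_trans _ _ ((2 * E) * ((2 * E) * expR (- Y) ^+ 6))).
  by do 2?apply: ler_pM; rewrite ?mulr_ge0 ?expR_ge0.
(* As E exp(- Y) = 1, the bound becomes 4 exp(- 3 Y) exp(- Y), and exp(- Y) <= 1/2 makes the first
   factor at most 1/2. *)
have -> : (2 * E) * ((2 * E) * expR (- Y) ^+ 6) =
  (E * expR (- Y)) ^+ 2 * (4 * expR (- Y) ^+ 3) * expR (- Y) by ring.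
rewrite EF expr1n mul1r -[ltRHS]mul1r ltr_pM2r//.
have F2 : expR (- Y) <= 2^-1.
  have := ler_wpM2r (ltW F0) E2; rewrite EF; lra.
have : expR (- Y) ^+ 3 <= (2^-1) ^+ 3 by rewrite lerXn2r ?nnegrE// ltW.
by rewrite [(2^-1) ^+ 3]exprS expr2; lra.
Qed.

(** * Both regimes with absolute constants *)

Theorem theorem2 (R : realType) :
  (exists C K : R, [/\ 0 < C, 0 < K &
    forall (n M : nat) (p delta alpha : R),
      (1 < n)%N -> 0 < p <= 1 -> 0 < alpha ->
      delta = p / 2 + alpha -> M%:R = (1 - delta) * n%:R ->
    forall (d : measure_display) (Omega : measurableType d)
      (P : probability Omega R) (v0 : 'I_n)
      (X : nat -> Omega -> config 'I_n M),
      lazy_dispersion P (@complete_graph n) p v0 X ->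
      ((1 - K / n%:R)%:E <=
        P [set w | T_Disp R X w <= (C * (p * alpha)^-1 * ln n%:R)%:E])%E])
  /\
  (exists c : R, 0 < c /\
    forall (n M : nat) (p delta alpha : R),
      (1 < n)%N -> 0 < p <= 1 -> 0 < alpha ->
      delta = p / 2 - alpha -> M%:R = (1 - delta) * n%:R ->
    forall (d : measure_display) (Omega : measurableType d)
      (P : probability Omega R) (v0 : 'I_n)
      (X : nat -> Omega -> config 'I_n M),
      lazy_dispersion P (@complete_graph n) p v0 X ->
      (P [set w | T_Disp R X w <= (expR (c * n%:R * p ^+ 2 * alpha ^+ 3))%:E]
        < (expR (- (c * n%:R * p ^+ 2 * alpha ^+ 3)))%:E)%E).
Proof.
split.
  exists 4, (expR 1); split; [by []|exact: expR_gt0|].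
  move=> n M p delta al n1 p01 al0 -> ME d Omega P v0 X.
  exact: fast_dispersion.
exists ((2^-1) ^+ 22); split; first by rewrite exprn_gt0.
move=> n M p delta al n1 p01 al0 -> ME d Omega P v0 X.
exact: slow_dispersion.
Qed.
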